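(* Let $m$ be a positive integer and let $\lambda$, $\mu$, $\nu$ be partitions of $m$ of length $p$, $q$, $r$, respectively. Let $t=\lambda_p$ and assume $p=qr$. Then we have: (1) If $\mu_q < rt$ or $\nu_r < qt$, then $\mathsf{k}(\lambda,\mu,\nu)=0$. (2) If $\mu_q\ge rt$ and $\nu_r\ge qt$, let $\widetilde\lambda=\lambda-(t)^p$, $\widetilde\mu=\mu-(rt)^q$ and $\widetilde\nu=\nu-(qt)^r$. Then $\mathsf{k}(\lambda,\mu,\nu)=\mathsf{k}(\widetilde\lambda,\widetilde\mu,\widetilde\nu)$.
   Context: A partition is a vector $\lambda=(\lambda_1,\dots,\lambda_p)$ of nonnegative integers with $\lambda_1\ge\cdots\ge\lambda_p$; two partitions differing only by a string of zeros at the end are considered equal. The length of a partition is the number of its positive parts; $\lambda$ is a partition of $m$ if its parts sum to $m$. For partitions $\lambda,\mu,\nu$ of $m$, let $\chi^\lambda,\chi^\mu,\chi^\nu$ be the corresponding complex irreducible characters of the symmetric group $\mathsf{S}_m$. The Kronecker coefficient is $\mathsf{k}(\lambda,\mu,\nu):=\langle \chi^\lambda\otimes\chi^\mu,\chi^\nu\rangle$, the multiplicity of $\chi^\nu$ in the Kronecker product $\chi^\lambda\otimes\chi^\mu$ (the pointwise product of characters), where $\langle\cdot,\cdot\rangle$ is the inner product of complex characters of $\mathsf{S}_m$. For $m=0$, $\mathsf{S}_0$ is the trivial group, so $\mathsf{k}(\varnothing,\varnothing,\varnothing)=1$. For nonnegative integers $a$ and positive integers $n$, $(a)^n$ denotes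 the vector $(a,\dots,a)$ with $n$ entries; differences such as $\lambda-(t)^p$ are differences of vectors. *)

(* Defs.v *)
From HB Require Import structures.
From mathcomp Require Import all_boot all_order all_algebra.
From mathcomp Require Import all_fingroup all_solvable all_field all_character.

Set Implicit Arguments.
Unset Strict Implicit.
Unset Printing Implicit Defensive.

Import GRing.Theory.
Local Open Scope nat_scope.

(* Trailing zeros are allowed: two lists that differ only by trailing zeros
   represent the same partition, and every notion below ignores them. *)
Definition is_partition (m : nat) (la : seq nat) : bool :=
  sorted geq la && (sumn la == m).

Definition partition_length (la : seq nat) : nat := count (ltn 0) la.

(* Parts are numbered from 1, and are zero beyond the end of the list. *)
Definition part (la : seq nat) (i : nat) : nat := nth 0 la i.-1.

(* Vectors of different sizes are padded with zeros; the entrywise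
   subtraction is the truncated one, and so is only meaningful when the
   entries of b do not exceed those of a. *)
Definition vec_sub (a b : seq nat) : seq nat :=
  mkseq (fun i => nth 0 a i - nth 0 b i) (maxn (size a) (size b)).

Definition conj_partition (la : seq nat) : seq nat :=
  mkseq (fun j => count (ltn j) la) (head 0 la).

(* reshape_index a i is the index of the block containing i when
   {0, ..., m - 1} is cut into consecutive blocks of sizes a_0, a_1, ... *)
Definition young_set (m : nat) (a : seq nat) : {set 'S_m} :=
  [set s : 'S_m | [forall i, reshape_index a (s i) == reshape_index a i]].

Lemma young_group_set m a : group_set (young_set m a).
Proof.
apply/group_setP; split=> [|s u]; first by rewrite inE; apply/forallP=> i; rewrite perm1.
rewrite !inE => /forallP hs /forallP hu; apply/forallP=> i.
by rewrite permM (eqP (hu _)).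
Qed.

Canonical young_subgroup m a := Group (young_group_set m a).

Lemma cfSign_subproof m :
  is_class_fun <<[set: 'S_m]>>%G [ffun s : 'S_m => ((-1) ^+ s)%R : algC].
Proof.
apply: intro_class_fun => [x y _ _ | x]; first by rewrite odd_permJ.
by rewrite mem_gen ?inE.
Qed.

Definition cfSign m : 'CF([set: 'S_m]) := Cfun 0 (cfSign_subproof m).

(* chi^la is the unique common irreducible constituent of the trivial
   character of S_la and the sign character of S_la', both induced to S_m
   (James and Kerber, The Representation Theory of the Symmetric Group,
   Section 2.1). The default value 0 is not used when la is a partition of m. *)
Definition sym_Iirr (m : nat) (la : seq nat) : Iirr [set: 'S_m] :=
  (odflt 0 [pick i : Iirr [set: 'S_m] |
    (i \in irr_constt ('Ind[[set: 'S_m], young_subgroup m la] 1)) &&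
    (i \in irr_constt ('Ind[[set: 'S_m], young_subgroup m (conj_partition la)]
                         ('Res (cfSign m))))])%R.

Definition sym_char (m : nat) (la : seq nat) : 'CF([set: 'S_m]) :=
  ('chi_(sym_Iirr m la))%R.

(* The degree of the symmetric group is read off la: kron is only meaningful
   on three partitions of the same integer. *)
Definition kron (la mu nu : seq nat) : algC :=
  let m := sumn la in '[sym_char m la * sym_char m mu, sym_char m nu]%R.

(* Main.v *)
Require Import Defs.
From mathcomp Require Import all_boot all_order all_algebra.
From mathcomp Require Import all_fingroup all_solvable all_field all_character.
From mathcomp Require Import zify.

(* Words of length m over a finite alphabet T, graded by content c, carry a
   permutation character phi^c of S_m (word_char m c below), and phi^c phi^d is the sum of the phi^N
   over the matrices N with margins c and d.  The irreducible character chi^la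
   is identified with the Jacobi-Trudi sum
     X^la = sum_w sgn(w) phi^(la_i - i + w(i)):
   a sign-reversing involution (the Pieri rule) shows that <X^la, phi^c> is
   zero unless la dominates c and is 1 for c = la, so X^la has norm 1; and
   counting 0-1 matrices (Gale-Ryser) shows that it is the common constituent
   defining chi^la.
   In n >= length(la) variables this makes <chi^la, X^(k + id)> alternating in
   the vector k, equal to 1 at k = la - id and to 0 at every other strictly
   decreasing k.  This description commutes with the translation of la and k by
   (t)^n, and inverting the alternating sum gives
   <chi^la, phi^c> = <chi^(la - t), phi^(c - t)> for every c with n entries.
   With n = qr, summing over q x r matrices c gives
   <chi^la, phi^a phi^b> = <chi^(la - t), phi^(a - rt) phi^(b - qt)>, and the
   theorem follows by expanding chi^mu and chi^nu as Jacobi-Trudi sums. *)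

Set Implicit Arguments.
Unset Strict Implicit.
Unset Printing Implicit Defensive.

Import Order.TTheory GRing.Theory Num.Theory.
Local Open Scope ring_scope.

(** * Characters of words *)

Section WordPermutation.
Variables (m : nat) (T : Type).
Implicit Types (w : {ffun 'I_m -> T}) (s x : 'S_m).

Definition wperm w s : {ffun 'I_m -> T} := [ffun i => w (s i)].

(** Products of permutations are read from left to right, so precomposition is a left action and the
    factors come out in reverse order. *)
Lemma wpermM w s x : wperm w (s * x)%g = wperm (wperm w x) s.
Proof. by apply/ffunP=> i; rewrite !ffunE permM. Qed.

Lemma wperm1 w : wperm w 1%g = w.
Proof. by apply/ffunP=> i; rewrite ffunE perm1. Qed.

Lemma wperm_inj s : injective (wperm^~ s).
Proof.
by apply: (can_inj (g := wperm^~ s^-1%g)) => w; rewrite -wpermM mulVg wperm1.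
Qed.

End WordPermutation.

Section Words.
Variables (m : nat) (T : finType).
Implicit Types (w : {ffun 'I_m -> T}) (c : {ffun T -> int}) (s x y : 'S_m).

(** Contents are integer vectors because a Jacobi-Trudi sum evaluates word characters at vectors
    with negative entries; no word has such a content, and the character is then 0. *)
Definition content w : {ffun T -> int} := [ffun t => #|[pred i | w i == t]|%:Z].

Lemma content_wperm w s : content (wperm w s) = content w.
Proof.
apply/ffunP=> t; rewrite !ffunE; congr Posz.
rewrite -(card_image (@perm_inj _ s)); apply: eq_card => i.
apply/imageP/idP => [[j]|]; rewrite !inE ?ffunE; first by move=> ? ->.
by move=> wi; exists (s^-1%g i); rewrite ?inE ?ffunE permKV.
Qed.

Lemma content_eqP w1 w2 :
  content w1 = content w2 -> exists s, w2 = wperm w1 s.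
Proof.
move=> /ffunP e12; have /tuple_permP[s es]: perm_eq [tuple w2 i | i < m] [tuple w1 i | i < m].
  apply/allP=> t _ /=; rewrite !count_map; have := e12 t; rewrite !ffunE => -[e].
  by rewrite -!size_filter -!enumT /= -?cardE eq_sym; move: e; rewrite !cardE !enumT /= => ->.
exists s; apply/ffunP=> i; rewrite ffunE.
have: tnth [tuple w2 i | i < m] i = tnth [tuple tnth [tuple w1 i  | i < m] (s i)  | i < m] i.
  by congr tnth; apply: val_inj; exact: es.
by rewrite !tnth_mktuple.
Qed.

Definition word_fix c s : {set {ffun 'I_m -> T}} :=
  [set w | (wperm w s == w) && (content w == c)].

Lemma word_char_subproof c :
  is_class_fun <<[set: 'S_m]>>%G [ffun s : 'S_m => #|word_fix c s|%:R : algC].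
Proof.
apply: intro_class_fun => [x y _ _ | x]; last by rewrite mem_gen ?inE.
congr _%:R; rewrite -(card_imset _ (@wperm_inj m T y)); apply: eq_card => w.
apply/imsetP/idP => [[w1]|]; rewrite !inE.
  case/andP=> /eqP fw cw ->; rewrite content_wperm cw andbT.
  by apply/eqP; rewrite -[in RHS]fw -!wpermM conjgE !mulgA mulgV mul1g.
case/andP=> /eqP fw cw; exists (wperm w y^-1%g); last by rewrite -wpermM mulgV wperm1.
rewrite inE content_wperm cw andbT -wpermM conjgE.
by rewrite -[in eqbRHS]fw -!wpermM !mulgA mulgK.
Qed.

Definition word_char c : 'CF([set: 'S_m]) := Cfun 0 (word_char_subproof c).

Lemma word_charE c s : word_char c s = #|word_fix c s|%:R.
Proof. by rewrite cfunE. Qed.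

Definition wstab_set w : {set 'S_m} := [set s | wperm w s == w].

Lemma wstab_group_set w : group_set (wstab_set w).
Proof.
apply/group_setP; split=> [|s u]; rewrite !inE ?wperm1 // wpermM.
by move=> /eqP es /eqP ->; rewrite es.
Qed.
Canonical wstab w := Group (wstab_group_set w).

(** The words with the content of w form one orbit of [S_m], with stabilizer [wstab w]. Up to the
    order of the stabilizer, the induced character at x counts the y for which x fixes [wperm w y];
    these are grouped by the word they produce. *)
Lemma word_char_Ind w : word_char (content w) = 'Ind[[set: 'S_m], wstab w] 1.
Proof.
apply/cfunP=> x; rewrite word_charE cfIndE ?subsetT //.
have -> : \sum_(y in [set: 'S_m]) (1 : 'CF(wstab w)) (x ^ y)%g =
   \sum_(v in word_fix (content w) x) \sum_(y | wperm w y == v) 1 :> algC.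
  rewrite (eq_bigr (fun y => if wperm w y \in word_fix (content w) x then 1 else 0)); last first.
    move=> y _; rewrite cfun1E !inE content_wperm eqxx andbT -!wpermM.
    have -> : (wperm w (x * y) == wperm w y) = (wperm w (x ^ y) == w).
      rewrite -(inj_eq (@wperm_inj m T y) (wperm w (x ^ y))).
      by rewrite -wpermM conjgE !mulgA mulgV mul1g.
    by case: eqP.
  rewrite (eq_bigl xpredT) ?inE => [|y]; last by rewrite inE.
  rewrite -big_mkcond /= (partition_big (wperm w) (mem (word_fix (content w) x))) //.
  apply: eq_bigr => v vin; apply: eq_bigl => y.
  by case: eqP => [->|]; rewrite ?andbT ?andbF.
(* The y that carry w to a given word form a left coset of the stabilizer. *)
rewrite (eq_bigr (fun _ => #|wstab w|%:R)).
  by rewrite sumr_const mulrnAr mulVf ?neq0CG.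
move=> v; rewrite inE => /andP[_ /eqP cv].
have [y0 ->] := content_eqP (esym cv).
rewrite sumr_const -(card_lcoset (wstab w) y0); congr _%:R.
apply: eq_card => y; rewrite mem_lcoset inE unfold_in.
rewrite -[LHS]/(wperm w y == wperm w y0).
by rewrite -(inj_eq (@wperm_inj m T y0^-1%g)) -!wpermM mulVg wperm1.
Qed.

Lemma word_char_char c : word_char c \is a character.
Proof.
have [[w /eqP <-]|nw] := pickP (fun w => content w == c).
  by rewrite word_char_Ind cfInd_char ?cfun1_char.
suff -> : word_char c = 0 by rewrite cfun0_char.
apply/cfunP=> s; rewrite word_charE [RHS]cfunE; apply/eqP; rewrite pnatr_eq0.
by apply/eqP/eq_card0 => w; rewrite !inE nw andbF.
Qed.

Lemma word_char_eq0 c : (forall w, content w != c) -> word_char c = 0.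
Proof.
move=> nw; apply/cfunP=> s; rewrite word_charE [RHS]cfunE.
by apply/eqP; rewrite pnatr_eq0; apply/eqP/eq_card0 => w; rewrite !inE (negPf (nw w)) andbF.
Qed.

Lemma content_ge0 w t : 0 <= content w t.
Proof. by rewrite ffunE. Qed.

Lemma sum_content w : \sum_t content w t = m%:Z.
Proof.
transitivity (\sum_t (\sum_(i | w i == t) 1)%N%:Z).
  by apply: eq_bigr => t _; rewrite ffunE sum1_card.
rewrite -(big_morph Posz PoszD (erefl _)); congr Posz.
rewrite -[RHS]card_ord -sum1_card (partition_big w xpredT) //=.
Qed.

Lemma word_char_neg c t : c t < 0 -> word_char c = 0.
Proof.
move=> ct; apply: word_char_eq0 => w; apply: contraTneq ct => <-.
by rewrite -leNgt content_ge0.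
Qed.

Lemma word_char_sum c : \sum_t c t != m%:Z -> word_char c = 0.
Proof. by move=> sc; apply: word_char_eq0 => w; apply: contraNneq sc => <-; rewrite sum_content. Qed.

Lemma content_exists (N : T -> nat) :
  (\sum_t N t)%N = m -> exists w, content w = [ffun t => (N t)%:Z].
Proof.
move=> sN; pose s := flatten [seq nseq (N t) t | t <- enum T].
have cs t : count_mem t s = N t.
  rewrite count_flatten -map_comp sumnE big_map big_enum /= (bigD1 t) //= count_nseq /= eqxx mul1n.
  by rewrite big1 ?addn0 // => u /negPf ut; rewrite count_nseq /= ut.
have ss : size s == m.
  rewrite size_flatten /shape -map_comp sumnE big_map big_enum /= -sN.
  by apply/eqP/eq_bigr => t _; rewrite /= size_nseq.
exists [ffun i => tnth (Tuple ss) i]; apply/ffunP=> t; rewrite !ffunE -(cs t); congr Posz.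
have es: s = [seq tnth (Tuple ss) i | i <- enum 'I_m] by rewrite map_tnth_enum.
rewrite [in RHS]es count_map cardE -size_filter; congr size.
by rewrite {1}/enum_mem -enumT; apply: eq_filter => i; rewrite !inE ffunE.
Qed.

Lemma cfdot_word_char1 (N : T -> nat) :
  (\sum_t N t)%N = m -> '[word_char [ffun t => (N t)%:Z], 1] = 1.
Proof.
by move=> /content_exists[w <-]; rewrite word_char_Ind -Frobenius_reciprocity cfRes_cfun1 // cfnorm1.
Qed.

End Words.

(** * Products and margins *)

Lemma word_char_reindex m (T U : finType) (f : T -> U) (c : {ffun U -> int}) :
  bijective f -> word_char m c = word_char m [ffun t => c (f t)].
Proof.
case=> g fK gK; apply/cfunP=> s; rewrite !word_charE; congr _%:R.
pose F (w : {ffun 'I_m -> T}) : {ffun 'I_m -> U} := [ffun i => f (w i)].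
have Finj : injective F.
  by move=> w1 w2 /ffunP e; apply/ffunP=> i; have := e i; rewrite !ffunE => /(can_inj fK).
have FP w : wperm (F w) s = F (wperm w s) by apply/ffunP=> i; rewrite !ffunE.
have FC w t : content (F w) (f t) = content w t.
  by rewrite !ffunE; congr Posz; apply: eq_card => i; rewrite !inE ffunE (can_eq fK).
have FCc w : (content (F w) == c) = (content w == [ffun t => c (f t)]).
  apply/eqP/eqP => [<-|e]; apply/ffunP=> t; first by rewrite -FC [RHS]ffunE.
  by rewrite -(gK t) FC e ffunE.
rewrite -(card_imset _ Finj); apply: eq_card => w.
apply/idP/imsetP => [|[w1]]; rewrite !inE.
  have -> : w = F [ffun i => g (w i)] by apply/ffunP=> i; rewrite !ffunE gK.
  by rewrite FP FCc (inj_eq Finj) => h; exists [ffun i => g (w i)]; rewrite ?inE.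
by move=> h ->; rewrite FP FCc (inj_eq Finj).
Qed.

(** Matrices and columns have entries in ['I_M], so that they form finite types over which sums can
    range. *)
Definition ffun_int (T : finType) M (N : {ffun T -> 'I_M}) : {ffun T -> int} :=
  [ffun t => (N t)%:Z].

Section Margins.
Variables (T U : finType).
Definition row_margin (N : {ffun T * U -> int}) : {ffun T -> int} :=
  [ffun t => \sum_u N (t, u)].
Definition col_margin (N : {ffun T * U -> int}) : {ffun U -> int} :=
  [ffun u => \sum_t N (t, u)].

Definition margins (c : {ffun T -> int}) (d : {ffun U -> int}) (N : {ffun T * U -> int}) :=
  (row_margin N == c) && (col_margin N == d).

Lemma row_margin_content m (w : {ffun 'I_m -> T * U}) :
  row_margin (content w) = content [ffun i => (w i).1].
Proof.
apply/ffunP=> t; rewrite !ffunE.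
under eq_bigr do rewrite ffunE.
rewrite -(big_morph Posz PoszD (erefl _)); congr Posz.
rewrite -sum1_card (partition_big (fun i => (w i).2) xpredT) //=.
apply: eq_bigr => u _; rewrite -sum1_card; apply: eq_bigl => i.
by rewrite !inE ffunE; case: (w i).
Qed.

Lemma col_margin_content m (w : {ffun 'I_m -> T * U}) :
  col_margin (content w) = content [ffun i => (w i).2].
Proof.
apply/ffunP=> u; rewrite !ffunE.
under eq_bigr do rewrite ffunE.
rewrite -(big_morph Posz PoszD (erefl _)); congr Posz.
rewrite -sum1_card (partition_big (fun i => (w i).1) xpredT) //=.
apply: eq_bigr => t _; rewrite -sum1_card; apply: eq_bigl => i.
by rewrite !inE ffunE; case: (w i) => a b /=; rewrite xpair_eqE andbC.
Qed.

(** A pair of words over T and U is one word over [T * U], fixed by s exactly when both are, and its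
    content is a matrix whose margins are the two contents. The entries of such a matrix are at most
    m, so any bound M >= m loses nothing. *)
Lemma word_char_mul m M (c : {ffun T -> int}) (d : {ffun U -> int}) : (m <= M)%N ->
  word_char m c * word_char m d =
  \sum_(N : {ffun T * U -> 'I_M.+1} | margins c d (ffun_int N)) word_char m (ffun_int N).
Proof.
move=> mM; apply/cfunP=> s; rewrite [LHS]cfunE sum_cfunE !word_charE -natrM.
under eq_bigr do rewrite word_charE.
rewrite -natr_sum; congr _%:R.
pose P (w : {ffun 'I_m -> T * U}) := [ffun i => (w i).1].
pose Q (w : {ffun 'I_m -> T * U}) := [ffun i => (w i).2].
pose R : {set {ffun 'I_m -> T * U}} := [set w | (wperm w s == w) && margins c d (content w)].
pose NN (w : {ffun 'I_m -> T * U}) : {ffun T * U -> 'I_M.+1} :=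
   [ffun x => inord #|[pred i | w i == x]|].
have NNE w : ffun_int (NN w) = content w.
  apply/ffunP=> x; rewrite !ffunE inordK // ltnS (leq_trans (max_card _)) //.
  by rewrite card_ord.
transitivity #|R|; last first.
  rewrite -sum1_card (partition_big NN (fun N => margins c d (ffun_int N))) /=; last first.
    by move=> w; rewrite inE NNE => /andP[].
  apply: eq_bigr => N mN; rewrite -sum1_card; apply: eq_bigl => w.
  rewrite !inE -andbA; congr andb.
  apply/andP/eqP => [[mw /eqP <-]|e]; first by rewrite NNE.
  rewrite e; split=> //; apply/eqP/ffunP=> x; have /ffunP/(_ x) := e.
  by rewrite !ffunE => -[e1]; apply: val_inj; rewrite /= e1 inordK.
rewrite -cardsX.
pose F (w : {ffun 'I_m -> T * U}) := (P w, Q w).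
have Finj : injective F.
  move=> w1 w2 [/ffunP e1 /ffunP e2]; apply/ffunP=> i; have := e1 i; have := e2 i.
  by rewrite !ffunE; case: (w1 i) (w2 i) => ? ? [? ?] /= -> ->.
have FR w : (F w \in setX (word_fix c s) (word_fix d s)) = (w \in R).
  rewrite !inE /= /margins row_margin_content col_margin_content andbACA; congr andb.
  have -> : (wperm w s == w) = (F (wperm w s) == F w) by rewrite (inj_eq Finj).
  rewrite xpair_eqE; congr andb; congr (_ == _); by apply/ffunP=> i; rewrite !ffunE.
rewrite -(card_imset _ Finj); apply: eq_card => -[u v].
apply/idP/imsetP => [|[w]]; last by rewrite -FR => ? ->.
have -> : (u, v) = F [ffun i => (u i, v i)].
  by congr pair; apply/ffunP=> i; rewrite !ffunE.
by rewrite FR => h; exists [ffun i => (u i, v i)].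
Qed.

End Margins.

Lemma cfSignE m (s : 'S_m) : cfSign m s = (-1) ^+ s.
Proof. by rewrite cfunE. Qed.

(** By Frobenius reciprocity this is the average of the sign over the stabilizer of w, which is
    trivial for an injective word and otherwise contains a transposition, whose translates cancel in
    pairs. *)
Lemma cfdot_word_char_sign m (T : finType) (w : {ffun 'I_m -> T}) :
  '[word_char m (content w), cfSign m] = (injectiveb w)%:R.
Proof.
rewrite word_char_Ind -Frobenius_reciprocity cfdotE.
under eq_bigr => s sw do rewrite cfun1E sw mul1r cfResE ?subsetT // cfSignE rmorph_sign.
case: injectiveP => [winj|].
  have -> : wstab w :=: 1%g.
    apply/trivgP/subsetP=> s; rewrite !inE => /eqP/ffunP sw.
    by apply/eqP/permP=> i; apply: winj; have := sw i; rewrite ffunE perm1.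
  by rewrite cards1 invr1 mul1r big_set1 odd_perm1.
move/injectiveP/injectivePn => [i [j ij wij]].
have tw : tperm i j \in wstab w.
  rewrite inE; apply/eqP/ffunP=> k; rewrite ffunE; case: tpermP => // ->; rewrite //.
set S := \sum_(_ in _) _.
suff : S = - S by move/eqP; rewrite -addr_eq0 -mulr2n mulrn_eq0 /= => /eqP ->; rewrite mulr0.
rewrite {1}/S (reindex_inj (mulIg (tperm i j))) -sumrN /=.
apply: eq_big => s; first by rewrite groupMr.
by move=> _; rewrite odd_permM odd_tperm ij signr_addb mulrN1.
Qed.

(** * Counting matrices *)

Lemma cfdot_word_charM m (T : finType) (f g : 'CF([set: 'S_m])) (c : {ffun T -> int}) :
  '[f, word_char m c * g] = '[f * word_char m c, g].
Proof.
rewrite !cfdotE; congr (_ * _); apply: eq_bigr => s _.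
by rewrite !cfunE rmorphM /= rmorph_nat mulrA.
Qed.

(** The number of matrices with row sums c, column sums d and entries at most M, computed by peeling
    off the columns one at a time. The Pieri rule acts on this recursion. *)
Fixpoint matrix_count n (M : nat) (d : seq nat) (c : {ffun 'I_n -> int}) : nat :=
  if d is k :: d' then
    (\sum_(b : {ffun 'I_n -> 'I_M.+1} | (\sum_i b i)%N == k) @matrix_count n M d' (c - ffun_int b)%R)%N
  else c == 0.

Definition ffun_seq l (d : seq nat) : {ffun 'I_l -> int} := [ffun i : 'I_l => (nth 0%N d i)%:Z].

Lemma card_margins n M d (c : {ffun 'I_n -> int}) :
  #|[pred N : {ffun 'I_n * 'I_(size d) -> 'I_M.+1}
      | margins c (ffun_seq (size d) d) (ffun_int N)]| = matrix_count M d c.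
Proof.
elim: d c => [|k d IHd] c /=.
  have e (N : {ffun 'I_n * 'I_0 -> 'I_M.+1}) : margins c (ffun_seq 0 [::]) (ffun_int N) = (c == 0).
    rewrite /margins andbC (_ : _ == _); last by apply/eqP/ffunP=> -[].
    rewrite andTb eq_sym; congr (_ == _); apply/ffunP=> t; rewrite !ffunE big_ord0 //.
  rewrite (eq_card (B := pred_of_simpl [pred N : {ffun 'I_n * 'I_0 -> 'I_M.+1} | c == 0])); last first.
    by move=> N; rewrite !inE e.
  case: (c == 0); last by rewrite eq_card0.
  by rewrite eq_cardT // -cardT card_ffun card_prod (card_ord 0) muln0 expn0.
pose X := {ffun 'I_n * 'I_(size d).+1 -> 'I_M.+1}.
pose cns (bN : {ffun 'I_n -> 'I_M.+1} * {ffun 'I_n * 'I_(size d) -> 'I_M.+1}) : X :=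
  [ffun x => if unlift ord0 x.2 is Some j then bN.2 (x.1, j) else bN.1 x.1].
have cns_bij : bijective cns.
  exists (fun N : X => ([ffun t => N (t, ord0)], [ffun x => N (x.1, lift ord0 x.2)])).
    move=> [b N]; congr pair; apply/ffunP.
      by move=> t; rewrite !ffunE unlift_none.
    by move=> [t u]; rewrite !ffunE liftK.
  move=> N; apply/ffunP=> -[t u]; rewrite !ffunE /=.
  by case: unliftP => [j|] ->; rewrite ?ffunE.
have e b N : margins c (ffun_seq (size d).+1 (k :: d)) (ffun_int (cns (b, N))) =
  ((\sum_i b i)%N == k) && margins (c - ffun_int b) (ffun_seq (size d) d) (ffun_int N).
  rewrite /margins andbCA; congr andb.
    apply/eqP/eqP => /ffunP e; apply/ffunP => t; have := e t;
      rewrite !ffunE big_ord_recl !ffunE /= unlift_none /=.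
      move=> <-; rewrite addrAC subrr add0r.
      by apply: eq_bigr => u _; rewrite !ffunE /= liftK.
    move=> e1; rewrite -[RHS](subrK (b t)%:Z) -e1 addrC; congr (_ + _).
    by apply: eq_bigr => u _; rewrite !ffunE /= liftK.
  apply/eqP/andP => [/ffunP e|[/eqP e1 /eqP/ffunP e2]].
    split; [have := e ord0|apply/eqP/ffunP=> u; have := e (lift ord0 u)]; rewrite !ffunE /=.
      under eq_bigr do rewrite !ffunE unlift_none /=.
      by rewrite -(big_morph Posz PoszD (erefl _)) => -[->].
    by under eq_bigr do rewrite !ffunE liftK /=; move=> <-; under eq_bigr do rewrite ffunE.
  apply/ffunP=> u; rewrite !ffunE /=; case: (unliftP ord0 u) => [j|] ->.
    have := e2 j; rewrite !ffunE /= => <-; apply: eq_bigr => t _.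
    by rewrite !ffunE liftK.
  under eq_bigr do rewrite !ffunE unlift_none /=.
  by rewrite -(big_morph Posz PoszD (erefl _)) e1.
rewrite -sum1_card (reindex cns) /=; last exact: onW_bij.
rewrite (eq_bigl (fun p : {ffun 'I_n -> 'I_M.+1} * {ffun 'I_n * 'I_(size d) -> 'I_M.+1} =>
  ((\sum_i p.1 i)%N == k) &&
  margins (c - ffun_int p.1) (ffun_seq (size d) d) (ffun_int p.2))); last by case.
rewrite -(pair_big_dep (fun b : {ffun 'I_n -> 'I_M.+1} => (\sum_i b i)%N == k)
  (fun b (N : {ffun 'I_n * 'I_(size d) -> 'I_M.+1}) =>
     margins (c - ffun_int b) (ffun_seq (size d) d) (ffun_int N)) (fun _ _ => 1%N)) /=.
by apply: eq_bigr => b _; rewrite sum1_card IHd.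
Qed.

(* Each orbit of S_m on pairs of words is given by the matrix counting the pairs of letters. *)
Lemma cfdot_word_char n m d (c : {ffun 'I_n -> int}) : sumn d = m ->
  '[word_char m c, word_char m (ffun_seq (size d) d)] = (matrix_count m d c)%:R.
Proof.
move=> sd; rewrite -[word_char m (ffun_seq _ _)]mulr1 cfdot_word_charM (word_char_mul _ _ (leqnn m)).
rewrite cfdot_suml -card_margins -sum1_card natr_sum; apply: eq_bigr => N /andP[_ /eqP/ffunP mN].
apply: (@cfdot_word_char1 m _ (fun x => N x : nat)).
rewrite -[RHS]sd [in RHS](sumnE d) (big_nth 0%N) big_mkord.
transitivity (\sum_u \sum_t N (t, u))%N.
  by rewrite exchange_big pair_big; apply: eq_bigr => -[].
apply: eq_bigr => u _; have := mN u; rewrite !ffunE -[nth _ _ _]/(nth 0%N d u) => -[e].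
apply/eqP; rewrite -eqz_nat -e (big_morph Posz PoszD (erefl _)); apply/eqP.
by apply: eq_bigr => t _; rewrite ffunE.
Qed.

(** * The Pieri rule *)

Definition shiftw n (k : {ffun 'I_n -> int}) (w : 'S_n) : {ffun 'I_n -> int} :=
  [ffun i => k i + (w i)%:Z].

(* The inner product of jacobi_trudi m k with the character of words of content d. *)
Definition alt_count n M d (k : {ffun 'I_n -> int}) : int :=
  \sum_(w : 'S_n) (-1) ^+ w * (matrix_count M d (shiftw k w))%:Z.

Definition decreasing n (k : {ffun 'I_n -> int}) := forall i j : 'I_n, (i < j)%N -> k j < k i.

Definition partial_sum n (c : {ffun 'I_n -> int}) (j : nat) : int := \sum_(i : 'I_n | (i < j)%N) c i.

(** For an integer vector k, [k + ord_weight n] is weakly decreasing exactly when k is strictly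
    decreasing; this is how partitions correspond to the vectors k. *)
Definition ord_weight n : {ffun 'I_n -> int} := [ffun i : 'I_n => (i : nat)%:Z].

Lemma wperm_shiftw n (k : {ffun 'I_n -> int}) s w :
  shiftw (wperm k s) w = wperm (shiftw k (s^-1 * w)%g) s.
Proof. by apply/ffunP=> i; rewrite !ffunE permM permK. Qed.

Lemma ffun_int_inj (T : finType) M : injective (@ffun_int T M).
Proof.
by move=> b1 b2 /ffunP e; apply/ffunP=> i; have := e i; rewrite !ffunE => -[/val_inj].
Qed.

Lemma matrix_count_wperm n M d (c : {ffun 'I_n -> int}) s : matrix_count M d (wperm c s) = matrix_count M d c.
Proof.
elim: d c => [|k d IHd] c /=.
  have -> : (0 : {ffun 'I_n -> int}) = wperm 0 s by apply/ffunP=> i; rewrite !ffunE.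
  by rewrite (inj_eq (@wperm_inj _ _ s)); congr (nat_of_bool (_ == _)); apply/ffunP=> i; rewrite !ffunE.
rewrite (reindex_inj (@wperm_inj _ _ s)) /=; apply: eq_big => b.
  congr (_ == _); rewrite [RHS](reindex_inj (@perm_inj _ s)) /=.
  by apply: eq_bigr => i _; rewrite ffunE.
by move=> _; rewrite -[RHS]IHd; congr matrix_count; apply/ffunP=> i; rewrite !ffunE.
Qed.

Lemma alt_count_wperm n M d (k : {ffun 'I_n -> int}) s :
  alt_count M d (wperm k s) = (-1) ^+ s * alt_count M d k.
Proof.
rewrite /alt_count (reindex_inj (mulgI s)) /= mulr_sumr; apply: eq_bigr => w _.
by rewrite wperm_shiftw mulKg matrix_count_wperm odd_permM signr_addb mulrA.
Qed.

Lemma alt_count_cons n M a d (k : {ffun 'I_n -> int}) :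
  alt_count M (a :: d) k =
  \sum_(b : {ffun 'I_n -> 'I_M.+1} | (\sum_i b i)%N == a) alt_count M d (k - ffun_int b).
Proof.
rewrite /alt_count exchange_big /=; apply: eq_bigr => w _.
rewrite -mulr_sumr (big_morph Posz PoszD (erefl _)); congr (_ * _).
apply: eq_bigr => b _; congr (Posz (matrix_count _ _ _)).
by apply/ffunP=> i; rewrite !ffunE addrAC.
Qed.

(** An increasing permutation satisfies i <= w i, and so does its inverse. *)
Lemma monotone_perm1 n (w : 'S_n) : (forall i j : 'I_n, (i < j)%N -> (w i < w j)%N) -> w = 1%g.
Proof.
have ge (u : 'S_n) : (forall i j : 'I_n, (i < j)%N -> (u i < u j)%N) -> forall i : 'I_n, (i <= u i)%N.
  move=> um [i]; elim: i => // i IHi Hi /=; have Hi' := ltnW Hi.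
  by apply: leq_ltn_trans (IHi Hi') (um _ _ _) => /=.
move=> wm; have wVm (i j : 'I_n) : (i < j)%N -> ((w^-1)%g i < (w^-1)%g j)%N.
  move=> ij; rewrite ltnNge; apply: contraTN ij => h; rewrite -leqNgt.
  move: h; rewrite leq_eqVlt => /orP[/eqP/val_inj/perm_inj -> //|/wm].
  by rewrite !permKV => /ltnW.
apply/permP=> i; apply: val_inj; rewrite perm1; apply/eqP; rewrite eqn_leq ge // andbT.
by have := ge _ wVm (w i); rewrite permK.
Qed.

(** If w fixes every index below i, the next partial sum gives w i <= i, and all smaller values are
    already taken. *)
Lemma partial_sum_le_perm1 n (w : 'S_n) :
  (forall j, \sum_(i : 'I_n | (i < j)%N) w i <= \sum_(i : 'I_n | (i < j)%N) i)%N -> w = 1%g.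
Proof.
move=> h; suff H (j : nat) (i : 'I_n) : (i < j)%N -> w i = i.
  by apply/permP=> i; rewrite perm1 (H i.+1).
elim: j i => // j IHj i; rewrite ltnS leq_eqVlt => /orP[/eqP ij|/IHj //].
have wi : (w i <= i)%N.
  have := h j.+1; rewrite (bigD1 i) ?ij //= [X in (_ <= X)%N](bigD1 i) ?ij //=.
  rewrite (eq_bigr (fun k : 'I_n => (k : nat))) ?leq_add2r ?ij // => k /andP[k1 ki].
  rewrite IHj //; move: k1; rewrite ltnS leq_eqVlt => /orP[/eqP kj|//].
  by case/eqP: ki; apply: val_inj; rewrite /= kj ij.
apply/eqP; move: wi; rewrite leq_eqVlt => /orP[//|wi].
by apply/eqP/(@perm_inj _ w); apply: IHj; rewrite -ij.
Qed.

(** With no column left only the zero vector counts, which forces k = -w; as k decreases, w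
    increases and is the identity. *)
Lemma alt_count_nil n M (k : {ffun 'I_n -> int}) : decreasing k ->
  alt_count M [::] k = (k == - ord_weight n)%:Z.
Proof.
move=> kd; have e (w : 'S_n) : (shiftw k w == 0) = (k == - ord_weight n) && (w == 1%g).
  apply/eqP/andP => [/ffunP e|[/eqP -> /eqP ->]]; last first.
    by apply/ffunP=> i; rewrite !ffunE perm1 addNr.
  have ew i : k i = - (w i)%:Z by have := e i; rewrite !ffunE => /eqP; rewrite addr_eq0 => /eqP.
  have w1 : w = 1%g.
    by apply: monotone_perm1 => i j /kd; rewrite !ew ltrN2 ltz_nat.
  by rewrite w1 eqxx; split=> //; apply/eqP/ffunP=> i; rewrite !ffunE ew w1 perm1.
rewrite /alt_count (bigD1 1%g) //= e eqxx andbT odd_perm1 mul1r big1 ?addr0 // => w w1.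
by rewrite /= e (negPf w1) andbF mulr0.
Qed.

(** With la = [k + ord_weight n] and mu = la - b, this says that mu_i < la_{i+1}: the boxes removed
    by b fail to form a horizontal strip at row i. *)
Definition bad n M (k : {ffun 'I_n -> int}) (b : {ffun 'I_n -> 'I_M.+1}) (i : 'I_n) :=
  [exists j : 'I_n, (j == i.+1 :> nat) && (k i - (b i)%:Z <= k j)].

Definition first_bad n M (k : {ffun 'I_n -> int}) (b : {ffun 'I_n -> 'I_M.+1}) (i : 'I_n) :=
  bad k b i && [forall j : 'I_n, (j < i)%N ==> ~~ bad k b j].

Section Pieri.
Variables (n M : nat) (G : {ffun 'I_n -> int} -> int) (k : {ffun 'I_n -> int}).
Hypothesis Galt : forall c s, G (wperm c s) = (-1) ^+ s * G c.
Hypothesis kdec : decreasing k.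

(* If i is the first violation of interlacing, exchanging the entries i and i + 1 of
   k - b gives another b with the same first violation, and changes the sign of G. *)
Lemma first_bad_cancel a (i : 'I_n) : (a <= M)%N ->
  \sum_(b : {ffun 'I_n -> 'I_M.+1} | ((\sum_i b i)%N == a) && first_bad k b i) G (k - ffun_int b) = 0.
Proof.
move=> aM; have [j ji|nj] := pickP (fun j : 'I_n => j == i.+1 :> nat); last first.
  rewrite big1 // => b /andP[_ /andP[/existsP[j]]]; by rewrite nj.
have ij : i != j by rewrite -val_eqE /= (eqP ji) ltn_eqF.
pose P (b : {ffun 'I_n -> 'I_M.+1}) := ((\sum_i b i)%N == a) && first_bad k b i.
pose t : 'S_n := tperm i j.
(* [g b] is the vector that, subtracted from k, leaves k - b with its entries i and j exchanged. *)
pose g (b : {ffun 'I_n -> 'I_M.+1}) : {ffun 'I_n -> int} := k - wperm (k - ffun_int b) t.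
have gE b x : g b x = k x - (k (t x) - (b (t x))%:Z) by rewrite !ffunE.
pose f (b : {ffun 'I_n -> 'I_M.+1}) : {ffun 'I_n -> 'I_M.+1} :=
  [ffun x : 'I_n => inord (absz (g b x))].
have badE b : P b -> k i - (b i)%:Z <= k j.
  case/andP=> _ /andP[/existsP[j' /andP[/eqP j'i h]] _].
  by rewrite (_ : j = j') //; apply: val_inj; rewrite /= (eqP ji) j'i.
have ble b x y : P b -> x != y -> (b x + b y <= M)%N.
  move=> /andP[/eqP sb _] xy; apply: leq_trans aM; rewrite -sb (bigD1 x) //= (bigD1 y) /= 1?eq_sym // addnA.
  exact: leq_addr.
have fE b : P b -> ffun_int (f b) = g b.
  move=> Pb; apply/ffunP=> x; rewrite [LHS]ffunE [f b x]ffunE.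
  (* The new entries at i and j are b_j + (k_i - k_j) and b_i - (k_i - k_j). Since k decreases and i
     is bad, 0 < k_i - k_j <= b_i, so both lie between 0 and b_i + b_j <= M, and [inord] and [absz]
     change nothing. *)
  have /andP[h0 hM] : 0 <= g b x <= M%:Z.
    apply/andP; rewrite gE /t; case: tpermP => [->|->|/eqP xi /eqP xj].
    - have := badE b Pb; have := kdec (i := i) (j := j); rewrite (eqP ji) ltnSn => /(_ isT).
      have := ble _ _ _ Pb ij; lia.
    - have := badE b Pb; have := kdec (i := i) (j := j); rewrite (eqP ji) ltnSn => /(_ isT).
      have := ble _ _ _ Pb ij; lia.
    - have := ble _ _ _ Pb xi; lia.
  by rewrite inordK ?gez0_abs // ltnS -lez_nat gez0_abs.
have Pf b : P b -> P (f b).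
  move=> Pb; have fb x : (f b x)%:Z = g b x by rewrite -fE // [RHS]ffunE.
  apply/andP; split.
    rewrite -eqz_nat (big_morph Posz PoszD (erefl _)); under eq_bigr do rewrite fb.
    have rt (F : 'I_n -> int) : \sum_x F (t x) = \sum_x F x.
      by rewrite [RHS](reindex_inj (@perm_inj _ t)).
    under eq_bigr do rewrite gE.
    rewrite !sumrB (rt k) (rt (fun x => (b x)%:Z)) opprB addrC subrK.
    by rewrite -(big_morph Posz PoszD (erefl _)) eqz_nat; case/andP: Pb.
  apply/andP; split.
    (* The index i stays bad because the new k_i - b_i is k_j - b_j <= k_j. Badness at an earlier
       index involves only entries of b untouched by the exchange. *)
    apply/existsP; exists j; rewrite ji /= fb gE tpermL; lia.
  apply/forallP=> x; apply/implyP=> xi; case/andP: Pb => _ /andP[_ /forallP/(_ x)].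
  rewrite xi /=; apply: contraNN => /existsP[y /andP[yx h]]; apply/existsP; exists y; rewrite yx /=.
  move: h; rewrite fb gE tpermD; [lia | |]; rewrite -val_eqE /=; first lia.
  by rewrite (eqP ji); lia.
have ff b : P b -> f (f b) = b.
  move=> Pb; apply: ffun_int_inj; rewrite (fE _ (Pf _ Pb)) /g (fE _ Pb).
  by apply/ffunP=> x; rewrite /g !ffunE tpermK; lia.
set S := \sum_(_ | _) _; suff : S = - S by lia.
rewrite {1}/S (reindex_onto f f) => [|b Pb]; last exact: ff.
rewrite -sumrN; apply: eq_big => [b|b].
  rewrite -/(P b) -/(P (f b)); apply/andP/idP => [[P1 /eqP P2]|Pb]; first by rewrite -P2 Pf.
  by rewrite Pf // ff.
rewrite -/(P (f b)) => /andP[Pfb /eqP ffb].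
have Pb : P b by rewrite -ffb Pf.
rewrite (fE b Pb) /g opprB addrC subrK Galt odd_tperm ij /= expr1 mulN1r //.
Qed.

(** The vectors b that violate interlacing are grouped by their first bad index, and each group
    cancels. *)
Lemma pieri a : (a <= M)%N ->
  \sum_(b : {ffun 'I_n -> 'I_M.+1} | (\sum_i b i)%N == a) G (k - ffun_int b) =
  \sum_(b : {ffun 'I_n -> 'I_M.+1} | ((\sum_i b i)%N == a) && [forall i, ~~ bad k b i])
     G (k - ffun_int b).
Proof.
move=> aM; rewrite (bigID (fun b => [forall i, ~~ bad k b i])) /= -[RHS]addr0; congr (_ + _).
rewrite (partition_big (fun b => [pick i | first_bad k b i]) xpredT) //= big1 // => -[i|] _.
  rewrite -[RHS](first_bad_cancel i aM); apply: eq_bigl => b.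
  rewrite -andbA; congr andb; apply/andP/idP => [[_]|fb].
    by case: pickP => // x fx /eqP[<-].
  split; first by apply/forallPn; exists i; rewrite negbK; case/andP: fb.
  case: pickP => [x fx|/(_ i)]; last by rewrite fb.
  apply/eqP; congr Some; apply: val_inj => /=; apply/eqP; rewrite eqn_leq.
  case/andP: fb => bi /forallP fi; case/andP: fx => bx /forallP fx.
  apply/andP; split; rewrite leqNgt; apply/negP => lt.
    by have := fx i; rewrite lt bi.
  by have := fi x; rewrite lt bx.
(* The group without a first bad index is empty: a violation somewhere implies a least one. *)
rewrite big_pred0 // => b; apply/negbTE; rewrite !negb_and; case: eqP => //= _.
case: forallP => //= nf; case: pickP => // nfb; case: nf.
suff H (N : nat) (i : 'I_n) : (i < N)%N -> ~~ bad k b i by move=> i; apply: (H i.+1).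
elim: N i => // N IHN i iN; apply/negP => bi; have := nfb i.
rewrite /first_bad bi /= => /forallP[]; move=> j; apply/implyP => ji; apply: IHN.
by apply: leq_trans ji _.
Qed.

End Pieri.

(** * Dominance *)

Lemma partial_sumS n (c : {ffun 'I_n -> int}) (i : 'I_n) : partial_sum c i.+1 = partial_sum c i + c i.
Proof.
rewrite /partial_sum (bigD1 i) //= addrC; congr (_ + _); apply: eq_bigl => j.
by rewrite ltnS ltn_neqAle andbC -val_eqE.
Qed.

Lemma partial_sum_ge n (c : {ffun 'I_n -> int}) j : (n <= j)%N -> partial_sum c j = \sum_i c i.
Proof. by move=> nj; apply: eq_bigl => i; rewrite (leq_trans (ltn_ord i)). Qed.

Lemma partial_sum_le n (c d : {ffun 'I_n -> int}) j :
  (forall i, c i <= d i) -> partial_sum c j <= partial_sum d j.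
Proof. by move=> cd; apply: ler_sum. Qed.

Lemma interlace_decreasing n M (k : {ffun 'I_n -> int}) (b : {ffun 'I_n -> 'I_M.+1}) :
  decreasing k -> (forall i j : 'I_n, j = i.+1 :> nat -> k j < k i - (b i)%:Z) ->
  decreasing (k - ffun_int b).
Proof.
move=> kd ik i j ij; rewrite !ffunE.
have i1n : (i.+1 < n)%N := leq_ltn_trans ij (ltn_ord j).
have h1 := ik i (Ordinal i1n) erefl.
have : k j <= k (Ordinal i1n); last by move=> h2; apply: le_lt_trans h1; apply: le_trans h2; rewrite gerBl.
move: ij; rewrite leq_eqVlt => /orP[/eqP e|/(kd (Ordinal i1n))/ltW //].
by rewrite (_ : Ordinal i1n = j) //; apply: val_inj.
Qed.

Lemma alt_count_cons_neq0 n M a d (k : {ffun 'I_n -> int}) : decreasing k -> (a <= M)%N ->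
  alt_count M (a :: d) k != 0 ->
  exists b : {ffun 'I_n -> 'I_M.+1},
    [/\ (\sum_i b i)%N = a, forall i j : 'I_n, j = i.+1 :> nat -> k j < k i - (b i)%:Z,
        decreasing (k - ffun_int b) & alt_count M d (k - ffun_int b) != 0].
Proof.
move=> kd aM; rewrite alt_count_cons (pieri (@alt_count_wperm n M d) kd aM) => nz.
have [b /and3P[/eqP sb /forallP nb nzb]|nb] := pickP (fun b : {ffun 'I_n -> 'I_M.+1} =>
    [&& (\sum_i b i)%N == a, [forall i, ~~ bad k b i] & alt_count M d (k - ffun_int b) != 0]); last first.
  case/eqP: nz; rewrite big1 // => b /andP[sb nbb]; apply/eqP.
  by have := nb b; rewrite sb nbb /= => /negbFE.
have ik (i j : 'I_n) : j = i.+1 :> nat -> k j < k i - (b i)%:Z.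
  move=> ji; rewrite ltNge; have := nb i; apply: contra => h.
  by apply/existsP; exists j; rewrite h ji eqxx.
by exists b; split=> //; apply: interlace_decreasing.
Qed.

Lemma alt_count_dominance n M d (k : {ffun 'I_n -> int}) : decreasing k -> (sumn d <= M)%N ->
  alt_count M d k != 0 ->
  [/\ forall i : 'I_n, 0 <= (k + ord_weight n) i,
      forall i : 'I_n, (size d <= i)%N -> (k + ord_weight n) i = 0,
      \sum_i (k + ord_weight n) i = (sumn d)%:Z
    & forall j, (sumn (drop (size d - j) d))%:Z <= partial_sum (k + ord_weight n) j].
Proof.
elim: d k => [|a d IHd] k kd sM.
  rewrite alt_count_nil // eqz_nat eqb0 negbK => /eqP->; rewrite addNr; split=> [i|i _||j].
  - by rewrite ffunE.
  - by rewrite ffunE.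
  - by rewrite big1 // => i _; rewrite ffunE.
  - by rewrite /partial_sum big1 // => i _; rewrite ffunE.
rewrite /= in sM; have aM : (a <= M)%N by apply: leq_trans sM; rewrite leq_addr.
move/(alt_count_cons_neq0 kd aM) => [b [sb ik kbd /(IHd _ kbd)[|ge0 z s dm]]].
  by apply: leq_trans sM; rewrite leq_addl.
set la : {ffun 'I_n -> int} := k + ord_weight n.
set mu : {ffun 'I_n -> int} := k - ffun_int b + ord_weight n in ge0 z s dm.
have lamu : la = mu + ffun_int b by rewrite /mu addrAC subrK.
have lamuE i : la i = mu i + (b i)%:Z by rewrite lamu !ffunE.
have sla : \sum_i la i = (a + sumn d)%N.
  under eq_bigr do rewrite lamuE.
  by rewrite big_split /= s -(big_morph Posz PoszD (erefl _)) sb addnC.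
have lage0 i : 0 <= la i by rewrite lamuE addr_ge0.
have zla (i : 'I_n) : ((size d).+1 <= i)%N -> la i = 0.
  (* Interlacing reads la_i <= mu_{i-1}, and row i - 1 of mu is empty by induction. *)
  move=> di; have i1 : (i.-1 < n)%N by have := ltn_ord i; lia.
  have := ik (Ordinal i1) i; rewrite /= prednK ?(leq_ltn_trans _ di) // => /(_ erefl).
  have /z : (size d <= Ordinal i1)%N by rewrite /=; lia.
  have := lage0 i; rewrite /la /mu !ffunE /=. lia.
split=> // j; have [jd|dj] := leqP j (size d).
  rewrite subSn //=; apply: le_trans (dm j) _; apply: partial_sum_le => i; rewrite lamuE; lia.
(* By definition [dj] is the equation [(size d).+1 - j == 0], so no entry is dropped; the rows from
   j on are empty. *)
rewrite (eqP dj) drop0 /= -sla; rewrite [leLHS](bigID (fun i : 'I_n => (i < j)%N)) /=.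
rewrite [X in _ + X]big1 ?addr0 // => i; rewrite -leqNgt => ji; apply: zla.
by apply: leq_trans ji.
Qed.

Definition trunc_weight n (la : {ffun 'I_n -> nat}) l : {ffun 'I_n -> int} :=
  [ffun i : 'I_n => (if (i < l)%N then la i else 0%N)%:Z].

(** Only one chain of horizontal strips has shape la and sizes la: the one that adds row after row.
    The induction removes the last row, which is the choice [b0]. *)
Lemma alt_count_diag n M (la : {ffun 'I_n -> nat}) :
  (forall i j : 'I_n, (i <= j)%N -> (la j <= la i)%N) -> (\sum_i la i <= M)%N ->
  alt_count M (rev [seq la i | i <- enum 'I_n]) ([ffun i => (la i)%:Z] - ord_weight n) = 1.
Proof.
move=> lad sM.
have tdec l : decreasing (trunc_weight la l - ord_weight n).
  move=> i j ij; rewrite !ffunE; have := lad i j (ltnW ij); case: ifP => jl; last by case: ifP; lia.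
  by rewrite (ltn_trans ij jl); lia.
suff H l : (l <= n)%N -> 
   alt_count M (rev (take l [seq la i | i <- enum 'I_n])) (trunc_weight la l - ord_weight n) = 1.
  rewrite -(H n) //; congr alt_count; first by rewrite take_oversize // size_map size_enum_ord.
  by apply/ffunP=> i; rewrite !ffunE ltn_ord.
elim: l => [|l IHl] ln.
  rewrite take0 alt_count_nil //; case: eqP => // -[]; apply/ffunP=> i; rewrite !ffunE sub0r //.
pose i0 := Ordinal ln.
have sz : size (take l [seq la i | i <- enum 'I_n]) = l.
  by rewrite size_take size_map size_enum_ord ln.
have laM i : (la i <= M)%N by apply: leq_trans sM; rewrite (bigD1 i) //= leq_addr.
have ls : (l < size [seq la i | i <- enum 'I_n])%N by rewrite size_map size_enum_ord.
rewrite (take_nth 0%N ls) rev_rcons.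
have -> : nth 0%N [seq la i | i <- enum 'I_n] l = la i0.
  by rewrite (nth_map i0) ?size_enum_ord // (nth_ord_enum i0 i0).
rewrite alt_count_cons (pieri (@alt_count_wperm n M _) (tdec _)) //.
have sMd : (sumn (rev (take l [seq la i | i <- enum 'I_n])) <= M)%N.
  rewrite sumn_rev (leq_trans _ sM) // -[X in (_ <= X)%N]big_enum -(big_map la xpredT id) -sumnE.
  by rewrite -{2}(cat_take_drop l [seq la i | i <- enum 'I_n]) sumn_cat leq_addr.
pose b0 : {ffun 'I_n -> 'I_M.+1} := [ffun i => if i == i0 then inord (la i0) else ord0].
have b0E i : b0 i = (if i == i0 then la i0 else 0%N) :> nat.
  by rewrite ffunE; case: ifP; rewrite // inordK ?ltnS.
have sb0 : (\sum_i b0 i)%N = la i0.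
  by rewrite (bigD1 i0) //= b0E eqxx big1 ?addn0 // => i /negPf ii; rewrite b0E ii.
have eb0 : trunc_weight la l.+1 - ord_weight n - ffun_int b0 = trunc_weight la l - ord_weight n.
  clearbody b0; apply/ffunP=> i; rewrite !ffunE b0E -val_eqE /= ltnS.
  case: (ltngtP i l) => [_|_|il]; rewrite ?subr0 //.
  rewrite (_ : i = i0); last exact: val_inj.
  by rewrite addrAC subrr.
rewrite (bigD1 b0) /=; last first.
  rewrite sb0 eqxx; apply/forallP => i; apply/negP => /existsP[j /andP[/eqP ji]].
  have := tdec l.+1 i j; rewrite ji ltnSn => /(_ isT); rewrite b0E.
  case: eqP => [ii|_]; last by lia.
  rewrite !ffunE ji ii /= ltnSn ltnn; lia.
rewrite eb0 IHl ?(ltnW ln) // big1 ?addr0 // => b /andP[/andP[/eqP sb /forallP nb] bb0].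
apply/eqP; apply: contraNT bb0 => nz; apply/eqP/ffunP => i; apply/val_inj.
have kbd : decreasing (trunc_weight la l.+1 - ord_weight n - ffun_int b).
  apply: interlace_decreasing => // i1 j ji; rewrite ltNge.
  by have := nb i1; apply: contra => h; apply/existsP; exists j; rewrite h ji eqxx.
(* The l remaining columns allow at most l rows, so a contributing b empties row i0; its sum [la i0]
   then leaves nothing for the other rows. *)
have [_ z _ _] := alt_count_dominance kbd sMd nz.
have bi0 : b i0 = la i0 :> nat.
  have := z i0; rewrite size_rev sz leqnn => /(_ isT); rewrite !ffunE /= ltnSn; lia.
rewrite /= b0E; case: eqP => [->|/eqP ii] //.
have : (\sum_(i | i != i0) b i == 0)%N.
  by move: sb; rewrite (bigD1 i0) //= bi0 => /eqP; rewrite -{2}[la i0 : nat]addn0 eqn_add2l.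
by rewrite sum_nat_eq0 => /forallP/(_ i); rewrite ii => /eqP.
Qed.

(** * Irreducibility of Jacobi-Trudi sums *)

(* X^la is the value at k = la - ord_weight n; shifting the argument by ord_weight n makes the family alternating in k. *)
Definition jacobi_trudi m n (k : {ffun 'I_n -> int}) : 'CF([set: 'S_m]) :=
  \sum_(w : 'S_n) (-1) ^+ w *: word_char m (shiftw k w).

Definition wt (T : finType) (la : {ffun T -> nat}) : {ffun T -> int} := [ffun i => (la i)%:Z].

(* matrix_count removes the columns from the head of the list, whereas dominance needs
   the last part of al to be removed first, hence the reversal. *)
Definition revseq n (al : {ffun 'I_n -> nat}) := rev [seq al i | i <- enum 'I_n].

Lemma sumn_take n (al : {ffun 'I_n -> nat}) j :
  (j <= n)%N -> (sumn (take j [seq al i | i <- enum 'I_n]))%:Z = partial_sum (wt al) j.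
Proof.
elim: j => [|j IHj] jn; first by rewrite take0 /partial_sum big1.
have ls : (j < size [seq al i | i <- enum 'I_n])%N by rewrite size_map size_enum_ord.
rewrite (take_nth 0%N ls) -cats1 sumn_cat /= addn0 PoszD IHj ?(ltnW jn) //.
rewrite -[j in RHS]/(nat_of_ord (Ordinal jn)) partial_sumS ffunE; congr (_ + Posz _).
by rewrite (nth_map (Ordinal jn)) ?size_enum_ord // (nth_ord_enum (Ordinal jn) (Ordinal jn)).
Qed.

Lemma size_revseq n (al : {ffun 'I_n -> nat}) : size (revseq al) = n.
Proof. by rewrite size_rev size_map size_enum_ord. Qed.

Lemma sumn_revseq n (al : {ffun 'I_n -> nat}) : sumn (revseq al) = (\sum_i al i)%N.
Proof. by rewrite sumn_rev sumnE big_map big_enum. Qed.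

Lemma sum_wt (T : finType) (al : {ffun T -> nat}) : \sum_i wt al i = (\sum_i al i)%N.
Proof. by rewrite (big_morph Posz PoszD (erefl _)); apply: eq_bigr => i _; rewrite ffunE. Qed.

Lemma word_char_revseq m n (al : {ffun 'I_n -> nat}) :
  word_char m (wt al) = word_char m (ffun_seq (size (revseq al)) (revseq al)).
Proof.
pose f u := rev_ord (cast_ord (size_revseq al) u).
rewrite (word_char_reindex m (f := f)); last first.
  exists (fun i => cast_ord (esym (size_revseq al)) (rev_ord i)) => i.
    by rewrite /f rev_ordK cast_ordK.
  by rewrite /f cast_ordKV rev_ordK.
congr word_char; apply/ffunP=> u; rewrite !ffunE; congr Posz.
have un : (u < n)%N by rewrite -[X in (_ < X)%N](size_revseq al).
rewrite /revseq nth_rev size_map size_enum_ord //.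
rewrite (nth_map (f u)) ?size_enum_ord; last by rewrite ltn_subrL; lia.
by rewrite -[(n - u.+1)%N]/(nat_of_ord (f u)) (nth_ord_enum (f u) (f u)).
Qed.

Lemma cfdot_jacobi_trudi_word_char m n (k : {ffun 'I_n -> int}) (al : {ffun 'I_n -> nat}) :
  (\sum_i al i)%N = m -> '[jacobi_trudi m k, word_char m (wt al)] = (alt_count m (revseq al) k)%:~R.
Proof.
move=> sal; rewrite word_char_revseq cfdot_suml rmorph_sum; apply: eq_bigr => w _ /=.
by rewrite cfdotZl cfdot_word_char ?sumn_revseq // rmorphM /= rmorph_sign.
Qed.

Lemma word_char_natP m (T : finType) (c : {ffun T -> int}) : word_char m c != 0 ->
  exists2 al : {ffun T -> nat}, c = wt al & (\sum_i al i)%N = m.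
Proof.
move=> nz; have c0 i : 0 <= c i.
  by rewrite leNgt; apply: contraNN nz => /word_char_neg ->.
have ec : c = wt [ffun i => absz (c i)] by apply/ffunP=> i; rewrite !ffunE gez0_abs.
exists [ffun i => absz (c i)] => //; apply/eqP; rewrite -eqz_nat -sum_wt -ec.
by apply: contraNT nz => /word_char_sum ->.
Qed.

Definition nonincreasing n (la : {ffun 'I_n -> nat}) := forall i j : 'I_n, (i <= j)%N -> (la j <= la i)%N.

Lemma wt_decreasing n (la : {ffun 'I_n -> nat}) : nonincreasing la -> decreasing (wt la - ord_weight n).
Proof. by move=> h i j ij; rewrite !ffunE ler_ltB // ?ltz_nat // lez_nat h // ltnW. Qed.

Lemma jacobi_trudi_dominance m n (k c : {ffun 'I_n -> int}) : decreasing k ->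
  '[jacobi_trudi m k, word_char m c] != 0 -> forall j, partial_sum c j <= partial_sum (k + ord_weight n) j.
Proof.
move=> kd nz j; have nzc : word_char m c != 0 by apply: contraNneq nz => ->; rewrite cfdot0r.
have [al ec sal] := word_char_natP nzc; move: nz; rewrite {}ec {nzc c}.
rewrite cfdot_jacobi_trudi_word_char // intr_eq0 => nz.
have sal2 : (sumn (revseq al) <= m)%N by rewrite sumn_revseq sal.
have [_ _ s dm] := alt_count_dominance kd sal2 nz.
have [jn|/ltnW nj] := leqP j n; last first.
  by rewrite !partial_sum_ge // s sum_wt sumn_revseq.
apply: le_trans (dm j); rewrite size_revseq drop_rev size_map size_enum_ord subKn //.
by rewrite sumn_rev sumn_take.
Qed.

Lemma jacobi_trudi_diag m n (la : {ffun 'I_n -> nat}) : nonincreasing la -> (\sum_i la i)%N = m ->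
  '[jacobi_trudi m (wt la - ord_weight n), word_char m (wt la)] = 1.
Proof. by move=> lad sla; rewrite cfdot_jacobi_trudi_word_char // alt_count_diag ?sla. Qed.

Lemma partial_sum_shiftw n (c : {ffun 'I_n -> int}) w j :
  partial_sum (shiftw (c - ord_weight n) w) j =
  partial_sum c j - (\sum_(i : 'I_n | (i < j)%N) i)%N%:Z + (\sum_(i : 'I_n | (i < j)%N) w i)%N%:Z.
Proof.
rewrite !(big_morph Posz PoszD (erefl _)) -sumrB -big_split /=.
by apply: eq_bigr => i _; rewrite !ffunE.
Qed.

Lemma shiftw_ord_weight1 n (c : {ffun 'I_n -> int}) : shiftw (c - ord_weight n) 1 = c.
Proof. by apply/ffunP=> i; rewrite !ffunE perm1 subrK. Qed.

(** The two partial sums differ by the partial sum of w i - i. This isolates the term w = 1 of a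
    Jacobi-Trudi sum once the contributing terms are known to be dominated by c. *)
Lemma dominates_shiftw n (c : {ffun 'I_n -> int}) w :
  (forall j, partial_sum (shiftw (c - ord_weight n) w) j <= partial_sum c j) -> w = 1%g.
Proof. by move=> h; apply: partial_sum_le_perm1 => j; have := h j; rewrite partial_sum_shiftw; lia. Qed.

(** Expanding one factor into word characters, dominance leaves only the term w = 1, given by
    [jacobi_trudi_diag]. *)
Lemma jacobi_trudi_norm m n (la : {ffun 'I_n -> nat}) : nonincreasing la -> (\sum_i la i)%N = m ->
  '[jacobi_trudi m (wt la - ord_weight n)] = 1.
Proof.
move=> lad sla; rewrite {2}/jacobi_trudi cfdot_sumr (bigD1 1%g) //= odd_perm1 scale1r shiftw_ord_weight1.
rewrite jacobi_trudi_diag // big1 ?addr0 // => w w1; rewrite cfdotZr; apply/eqP; rewrite mulf_eq0.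
apply/orP; right; apply: contraNT w1 => nz; apply/eqP/(@dominates_shiftw _ (wt la)) => j.
by have := jacobi_trudi_dominance (wt_decreasing lad) nz j; rewrite subrK.
Qed.

(** A virtual character of norm 1 is irreducible up to sign; the sign is positive because the inner
    product with a genuine character is 1. *)
Lemma jacobi_trudi_irr m n (la : {ffun 'I_n -> nat}) : nonincreasing la -> (\sum_i la i)%N = m ->
  exists i, jacobi_trudi m (wt la - ord_weight n) = 'chi_i.
Proof.
move=> lad sla; have := jacobi_trudi_norm lad sla; have := jacobi_trudi_diag lad sla.
have /vchar_norm1P h : jacobi_trudi m (wt la - ord_weight n) \in 'Z[irr [set: 'S_m]]%g.
  by apply: rpred_sum => w _; rewrite rpredZsign char_vchar ?word_char_char.
move=> e0 /h [b [i e]]; have : '[(-1) ^+ b *: 'chi_i, word_char m (wt la)] = 1 by rewrite -e e0.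
rewrite {}e cfdotZl; case: b => /= [|_]; last by exists i; rewrite scale1r.
rewrite mulN1r => /eqP; rewrite eqr_oppLR => /eqP e1.
have : 0 <= '[ 'chi_i, word_char m (wt la)] by rewrite natr_ge0 // Cnat_cfdot_char ?irr_char ?word_char_char.
by rewrite e1 oppr_ge0 ler10.
Qed.

(** * Translation *)

Lemma jacobi_trudi_wperm m n (k : {ffun 'I_n -> int}) s :
  jacobi_trudi m (wperm k s) = (-1) ^+ s *: jacobi_trudi m k.
Proof.
rewrite /jacobi_trudi (reindex_inj (mulgI s)) /= scaler_sumr; apply: eq_bigr => w _.
rewrite wperm_shiftw mulKg odd_permM signr_addb scalerA; congr (_ *: _).
by rewrite [RHS](word_char_reindex _ (f := s)) //; apply: injF_bij; apply: perm_inj.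
Qed.

Lemma add_ord_weightE n (k : {ffun 'I_n -> int}) (i : 'I_n) : (k + ord_weight n) i = k i + (i : nat)%:Z.
Proof. by rewrite !ffunE. Qed.

(** Since [k + ord_weight n] is weakly decreasing, its last entry is negative too. Every w adds at
    most n - 1 to the last entry of k, so every term has a content with a negative entry. *)
Lemma jacobi_trudi_neg m n (k : {ffun 'I_n -> int}) i :
  decreasing k -> (k + ord_weight n) i < 0 -> jacobi_trudi m k = 0.
Proof.
move=> kd ki; have n0 : (n.-1 < n)%N by have := ltn_ord i; lia.
pose l := Ordinal n0; have kl : k l + (n.-1)%:Z < 0.
  have [il|li] := ltnP i l.
    have H (j : nat) (jn : (j < n)%N) : (i <= j)%N -> k (Ordinal jn) + j%:Z <= k i + i%:Z.
      elim: j jn => [|j IHj] jn.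
        by rewrite leqn0 => /eqP i0; rewrite (_ : i = Ordinal jn) //; apply: val_inj.
      rewrite leq_eqVlt => /orP[/eqP ij|]; first by rewrite (_ : i = Ordinal jn) //; apply: val_inj.
      rewrite ltnS => ij; apply: le_trans (IHj (ltnW jn) ij).
      have /= := kd (Ordinal (ltnW jn)) (Ordinal jn) (ltnSn _); lia.
    by rewrite add_ord_weightE in ki; apply: le_lt_trans (H _ n0 (ltnW il)) ki.
  rewrite (_ : i = l) in ki; first by rewrite add_ord_weightE in ki.
  by apply: val_inj => /=; have := ltn_ord i; move: li => /=; lia.
rewrite /jacobi_trudi big1 // => w _; rewrite (@word_char_neg _ _ _ l) ?scaler0 // ffunE.
apply: le_lt_trans kl; by rewrite lerD2l lez_nat -ltnS (leq_trans (ltn_ord (w l))) ?leqSpred.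
Qed.

Lemma jacobi_trudi_sum m n (k : {ffun 'I_n -> int}) :
  \sum_i (k + ord_weight n) i != m%:Z -> jacobi_trudi m k = 0.
Proof.
move=> ks; rewrite /jacobi_trudi big1 // => w _; rewrite word_char_sum ?scaler0 //.
apply: contraNneq ks => <-; apply/eqP.
under eq_bigr do rewrite !ffunE; under [RHS]eq_bigr do rewrite !ffunE.
by rewrite !big_split; congr (_ + _); rewrite (reindex_inj (@perm_inj _ w)).
Qed.

Lemma partial_sum_inj n (c d : {ffun 'I_n -> int}) : (forall j, partial_sum c j = partial_sum d j) -> c = d.
Proof.
move=> h; apply/ffunP=> i; have := h i.+1; rewrite !partial_sumS h => /eqP.
by rewrite (inj_eq (addrI _)) => /eqP.
Qed.

(** If [k + ord_weight n] is a partition mu of m, both sums are irreducible, and if they coincide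
    then la and mu dominate each other. Otherwise [k + ord_weight n] has a negative entry or a wrong
    total, and the sum at k is 0. *)
Lemma cfdot_jacobi_trudi m n (la : {ffun 'I_n -> nat}) (k : {ffun 'I_n -> int}) :
  nonincreasing la -> (\sum_i la i)%N = m -> decreasing k ->
  '[jacobi_trudi m (wt la - ord_weight n), jacobi_trudi m k] = (k == wt la - ord_weight n)%:R.
Proof.
move=> lad sla kd; case: eqP => [->|kla]; first exact: jacobi_trudi_norm.
have [i ki|kge0] := pickP (fun i => (k + ord_weight n) i < 0).
  by rewrite (jacobi_trudi_neg _ kd ki) cfdot0r.
have [ks|ks] := eqVneq (\sum_i (k + ord_weight n) i) m%:Z; last by rewrite (jacobi_trudi_sum ks) cfdot0r.
pose mu : {ffun 'I_n -> nat} := [ffun i => absz ((k + ord_weight n) i)].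
have emu : wt mu = k + ord_weight n.
  by apply/ffunP=> i; rewrite [LHS]ffunE [mu i]ffunE gez0_abs // leNgt kge0.
have ek : k = wt mu - ord_weight n by rewrite emu addrK.
have smu : (\sum_i mu i)%N = m by apply/eqP; rewrite -eqz_nat -sum_wt emu ks.
have mud : nonincreasing mu.
  move=> i j; rewrite leq_eqVlt => /orP[/eqP/val_inj -> //|ij].
  suff : wt mu j <= wt mu i by rewrite !ffunE.
  have [N Nj] : exists N, (j < N)%N by exists j.+1.
  elim: N j ij Nj => // N IHN j ij; rewrite ltnS leq_eqVlt => /orP[/eqP jN|]; last exact: IHN.
  have j1 : (j.-1 < n)%N by have := ltn_ord j; lia.
  pose l := Ordinal j1; have lj : (l < j)%N by rewrite /=; lia.
  apply: (@le_trans _ _ (wt mu l)).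
    by rewrite emu !add_ord_weightE; have := kd _ _ lj; rewrite /=; lia.
  have : (i <= l)%N by rewrite /=; lia.
  rewrite leq_eqVlt => /orP[/eqP/val_inj -> //|il]; apply: IHN => //.
  by rewrite /=; lia.
have [i ei] := jacobi_trudi_irr lad sla; have [j ej] := jacobi_trudi_irr mud smu.
rewrite ek.
have : '[jacobi_trudi m (wt la - ord_weight n), jacobi_trudi m (wt mu - ord_weight n)] = (i == j)%:R.
  by rewrite ei ej cfdot_irr.
move=> ->; case: eqP => // ij; case: kla; rewrite ek; congr (_ - _).
have eA : jacobi_trudi m (wt la - ord_weight n) = jacobi_trudi m (wt mu - ord_weight n) by rewrite ei ej ij.
apply: partial_sum_inj => l; apply/eqP; rewrite eq_le.
have h1 : '[jacobi_trudi m (wt la - ord_weight n), word_char m (wt mu)] != 0.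
  by rewrite eA jacobi_trudi_diag ?oner_neq0.
have h2 : '[jacobi_trudi m (wt mu - ord_weight n), word_char m (wt la)] != 0.
  by rewrite -eA jacobi_trudi_diag ?oner_neq0.
have := jacobi_trudi_dominance (wt_decreasing lad) h1 l; rewrite subrK => ->.
by have := jacobi_trudi_dominance (wt_decreasing mud) h2 l; rewrite subrK => ->.
Qed.

Lemma sort_decreasing n (k : {ffun 'I_n -> int}) : injective k ->
  exists s, decreasing (wperm k s).
Proof.
move=> kinj; have /tuple_permP[s es] : perm_eq (sort >=%O [tuple k i | i < n]) [tuple k i | i < n].
  by rewrite perm_sort.
exists s; have srt : sorted >=%O [tuple tnth [tuple k i | i < n] (s i) | i < n].
  by rewrite -es sort_sorted // => x y; apply: le_total.
have nthE (i : 'I_n) : nth 0 [tuple tnth [tuple k i | i < n] (s i) | i < n] i = k (s i).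
  by rewrite -tnth_nth !tnth_mktuple.
move=> i j ij; rewrite !ffunE lt_neqAle; apply/andP; split.
  rewrite (inj_eq kinj) (inj_eq (@perm_inj _ s)) -val_eqE /=; lia.
rewrite -!nthE; apply: (sorted_leq_nth _ _ 0 srt); rewrite ?inE ?size_tuple //.
- by move=> x y z h1 h2; apply: le_trans h2 h1.
- by move=> x; apply: lexx.
- exact: ltnW.
Qed.

Lemma jacobi_trudi_noninj m n (k : {ffun 'I_n -> int}) i j : i != j -> k i = k j -> jacobi_trudi m k = 0.
Proof.
move=> ij kij; have : jacobi_trudi m (wperm k (tperm i j)) = jacobi_trudi m k.
  by congr jacobi_trudi; apply/ffunP=> x; rewrite ffunE; case: tpermP => // ->.
rewrite jacobi_trudi_wperm odd_tperm ij expr1 scaleN1r => /eqP.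
by rewrite eq_sym -addr_eq0 -mulr2n -scaler_nat scaler_eq0 pnatr_eq0 /= => /eqP.
Qed.

Definition cst_weight (T : finType) (t : nat) : {ffun T -> int} := [ffun => t%:Z].

(** The sum of the squares of i - w i is positive, and the squares of i and of w i have the same
    total. *)
Lemma rearrangement n (w : 'S_n) : w != 1%g ->
  \sum_(i < n) (i : nat)%:Z * (w i : nat)%:Z < \sum_(i < n) (i : nat)%:Z * (i : nat)%:Z.
Proof.
move=> w1; have [i wi] : exists i, w i != i.
  apply/existsP; apply: contraNT w1 => /existsPn h; apply/eqP/permP=> i.
  by rewrite perm1; have := h i; rewrite negbK => /eqP.
have : 0 < \sum_(i < n) ((i : nat)%:Z - (w i : nat)%:Z) ^+ 2.
  rewrite (bigD1 i) //= ltr_wpDr ?sumr_ge0 // => [j _|]; first exact: sqr_ge0.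
  by rewrite exprn_even_gt0 //= subr_eq0 eqz_nat eq_sym.
have -> : \sum_(i < n) ((i : nat)%:Z - (w i : nat)%:Z) ^+ 2 =
   \sum_(i < n) (i : nat)%:Z ^+ 2 - (\sum_(i < n) (i : nat)%:Z * (w i : nat)%:Z) *+ 2 
     + \sum_(i < n) (w i : nat)%:Z ^+ 2.
  by under eq_bigr do rewrite sqrrB; rewrite big_split sumrB sumrMnl.
have <- : \sum_(i < n) (i : nat)%:Z ^+ 2 = \sum_(i < n) (w i : nat)%:Z ^+ 2.
  by rewrite (reindex_inj (@perm_inj _ w)).
under [X in _ -> _ < X]eq_bigr do rewrite -expr2.
set a := \sum_(i < n) _; set b := \sum_(i < n) _; lia.
Qed.

Section Shift.
Variables (m n t : nat) (la mu : {ffun 'I_n -> nat}).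
Hypothesis lad : nonincreasing la.
Hypothesis sla : (\sum_i la i)%N = (m + n * t)%N.
Hypothesis muE : forall i, la i = (mu i + t)%N.

Lemma shift_nonincreasing : nonincreasing mu.
Proof. by move=> i j /lad; rewrite !muE leq_add2r. Qed.

Lemma shift_sum : (\sum_i mu i)%N = m.
Proof.
move: sla; under eq_bigr do rewrite muE.
by rewrite big_split sum_nat_const card_ord /= => /addIn.
Qed.

Lemma wt_shift : wt mu = wt la - cst_weight 'I_n t.
Proof. by apply/ffunP=> i; rewrite !ffunE muE PoszD addrK. Qed.

(** Both sides are alternating in k. They vanish when two entries of k are equal; otherwise k can be
    sorted, and each side then tests whether the sorted vector is [wt la - ord_weight n]. *)
Lemma cfdot_jacobi_trudi_shift (k : {ffun 'I_n -> int}) :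
  '[jacobi_trudi (m + n * t) (wt la - ord_weight n), jacobi_trudi (m + n * t) k] =
  '[jacobi_trudi m (wt mu - ord_weight n), jacobi_trudi m (k - cst_weight 'I_n t)].
Proof.
have [/injectiveP kinj|/injectivePn[i [j ij kij]]] := boolP (injectiveb k); last first.
  rewrite (jacobi_trudi_noninj _ ij kij) (@jacobi_trudi_noninj _ _ (k - cst_weight 'I_n t) i j) ?cfdot0r //.
  by rewrite !ffunE kij.
have [s kd] := sort_decreasing kinj.
suff H : '[jacobi_trudi (m + n * t) (wt la - ord_weight n), jacobi_trudi (m + n * t) (wperm k s)] =
   '[jacobi_trudi m (wt mu - ord_weight n), jacobi_trudi m (wperm (k - cst_weight 'I_n t) s)].
  move: H; rewrite !jacobi_trudi_wperm !cfdotZr => /mulfI; apply.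
  by rewrite rmorph_sign signr_eq0.
have e : wperm (k - cst_weight 'I_n t) s = wperm k s - cst_weight 'I_n t.
  by apply/ffunP=> i; rewrite !ffunE.
rewrite e !cfdot_jacobi_trudi ?shift_sum //; first last.
- by move=> i j ij; rewrite !ffunE ltrD2r; have := kd i j ij; rewrite !ffunE.
- exact: shift_nonincreasing.
by rewrite wt_shift (addrAC _ (- cst_weight _ _)) (inj_eq (addIr _)).
Qed.

(** The defect of the translation identity for word characters. Its alternating sums vanish and its
    support consists of nonnegative vectors, which together force it to be 0. *)
Let E (c : {ffun 'I_n -> int}) : algC :=
  '[jacobi_trudi (m + n * t) (wt la - ord_weight n), word_char (m + n * t) c] -
  '[jacobi_trudi m (wt mu - ord_weight n), word_char m (c - cst_weight 'I_n t)].

Let E_alt k : \sum_(w : 'S_n) (-1) ^+ w * E (shiftw k w) = 0.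
Proof.
transitivity ('[jacobi_trudi (m + n * t) (wt la - ord_weight n), jacobi_trudi (m + n * t) k] -
   '[jacobi_trudi m (wt mu - ord_weight n), jacobi_trudi m (k - cst_weight 'I_n t)]); last first.
  by rewrite cfdot_jacobi_trudi_shift subrr.
rewrite [jacobi_trudi (m + n * t) k]/jacobi_trudi [jacobi_trudi m (k - _)]/jacobi_trudi !cfdot_sumr -sumrB.
apply: eq_bigr => w _; rewrite !cfdotZr rmorph_sign -mulrBr.
congr (_ * (_ - '[_, word_char m _])).
by apply/ffunP=> i; rewrite !ffunE addrAC.
Qed.

Let E_supp c : E c != 0 -> forall i, 0 <= c i.
Proof.
move=> nz i; rewrite leNgt; apply: contraNN nz => ci.
rewrite /E (word_char_neg _ ci) (@word_char_neg _ _ _ i) ?cfdot0r ?subrr // !ffunE.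
by rewrite subr_lt0; apply: lt_le_trans ci _.
Qed.

Lemma cfdot_jacobi_trudi_word_char_shift (c : {ffun 'I_n -> int}) :
  '[jacobi_trudi (m + n * t) (wt la - ord_weight n), word_char (m + n * t) c] =
  '[jacobi_trudi m (wt mu - ord_weight n), word_char m (c - cst_weight 'I_n t)].
Proof.
apply/eqP; rewrite -subr_eq0 -/(E c).
(* E_alt at d - ord_weight n expresses E d through values of E at vectors with smaller J. *)
pose J (c : {ffun 'I_n -> int}) : int := \sum_(i < n) (i : nat)%:Z * c i.
suff H (N : nat) d : J d < N%:Z -> E d == 0.
  by apply: (H (absz (J c)).+1); lia.
elim: N d => [|N IHN] d JN.
  (* J is nonnegative on the support of E, which starts the induction. *)
  apply: contraLR JN => /E_supp d0; rewrite -leNgt sumr_ge0 // => i _.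
  exact: mulr_ge0.
have := E_alt (d - ord_weight n); rewrite (bigD1 1%g) //= odd_perm1 mul1r shiftw_ord_weight1.
rewrite big1 ?addr0 => [->//|w w1]; apply/eqP; rewrite mulf_eq0 IHN ?orbT //.
have -> : J (shiftw (d - ord_weight n) w) = J d - \sum_(i < n) (i : nat)%:Z * (i : nat)%:Z
    + \sum_(i < n) (i : nat)%:Z * (w i : nat)%:Z.
  rewrite -sumrB -big_split; apply: eq_bigr => i _.
  by rewrite !ffunE mulrDr mulrBr.
have := rearrangement w1; lia.
Qed.

End Shift.

(** * Zero-one matrices *)

Lemma wtE (T : finType) (al : {ffun T -> nat}) i : wt al i = (al i)%:Z.
Proof. by rewrite ffunE. Qed.

Lemma cfdot_word_char_wt_sign m (T : finType) (N : {ffun T -> nat}) :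
  '[word_char m (wt N), cfSign m] = ([forall x, (N x <= 1)%N] && ((\sum_x N x)%N == m))%:R.
Proof.
case: eqP => [sN|/eqP sN]; last first.
  by rewrite word_char_sum ?cfdot0l ?andbF // sum_wt eqz_nat.
have [w ew] : exists w : {ffun 'I_m -> T}, content w = wt N.
  by have [w ew] := content_exists sN; exists w; rewrite ew; apply/ffunP=> x; rewrite !ffunE.
rewrite -ew cfdot_word_char_sign andbT; congr (nat_of_bool _)%:R.
have eN x : N x = #|[pred i | w i == x]|.
  by move/ffunP/(_ x): ew; rewrite !ffunE => -[].
apply/injectiveP/forallP => [winj x|h i j wij].
  rewrite eN; apply/card_le1_eqP => i j; rewrite !inE => /eqP wi /eqP wj.
  by apply: winj; rewrite wi.
have := h (w i); rewrite eN => /card_le1_eqP; apply; rewrite inE //.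
by rewrite wij.
Qed.

Lemma sum_ltn_ord l k : (\sum_(j < l) (j < k : nat))%N = minn k l.
Proof.
elim: l => [|l IHl]; first by rewrite big_ord0 minn0.
by rewrite big_ord_recr /= IHl; lia.
Qed.

Section GaleRyser.
Variables (n l : nat) (la : {ffun 'I_n -> nat}).
Hypothesis lad : nonincreasing la.
Hypothesis lal : forall i, (la i <= l)%N.

(** The conjugate partition as a vector of l entries, where l may be any bound on the parts. *)
Definition col_height : {ffun 'I_l -> nat} := [ffun j : 'I_l => #|[pred i | (j < la i)%N]|].

Let m := (\sum_i la i)%N.

Let ferrers : {ffun 'I_n * 'I_l -> nat} := [ffun x : 'I_n * 'I_l => (x.2 < la x.1 : nat)%N].

(** Among 0-1 columns of a given sum, the column of the Ferrers diagram has its ones pushed to the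
    top, so it has the most ones in the first k rows. *)
Lemma partial_column (N : 'I_n -> 'I_l -> nat) (j : 'I_l) k :
  (forall i, N i j <= 1)%N -> (\sum_i N i j)%N = col_height j ->
  (\sum_(i < n | (i < k)%N) N i j <= \sum_(i < n | (i < k)%N) (j < la i : nat))%N.
Proof.
move=> N1 sN; have [/existsP[i0 /andP[ki0 ji0]]|] := boolP [exists i : 'I_n, (i < k)%N && ~~ (j < la i)%N].
  have -> : (\sum_(i < n | (i < k)%N) (j < la i : nat))%N = (\sum_i N i j)%N.
    rewrite sN ffunE -sum1_card [RHS]big_mkcond [LHS]big_mkcond; apply: eq_bigr => i _ /=.
    rewrite inE; case: ifP => [|/negbT]; first by case: (_ < la i)%N.
    rewrite -leqNgt => ki; rewrite ifN // -leqNgt (leq_trans (lad (ltnW (leq_trans ki0 ki)))) //.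
    by rewrite leqNgt.
  by rewrite [X in (_ <= X)%N](bigID (fun i : 'I_n => (i < k)%N)) leq_addr.
move=> /existsPn h; apply: leq_sum => i ik; have := h i; rewrite ik negbK /= => ->.
exact: N1.
Qed.

Lemma sum_partial_columns k :
  (\sum_(j < l) \sum_(i < n | (i < k)%N) (j < la i : nat))%N = (\sum_(i < n | (i < k)%N) la i)%N.
Proof.
by rewrite exchange_big; apply: eq_bigr => i _; rewrite sum_ltn_ord (minn_idPl (lal _)).
Qed.

Lemma partial_sum_wt (T : {ffun 'I_n -> nat}) k : partial_sum (wt T) k = (\sum_(i < n | (i < k)%N) T i)%N.
Proof. by rewrite (big_morph Posz PoszD (erefl _)); apply: eq_bigr => i _; rewrite ffunE. Qed.

Let mass (N : {ffun 'I_n * 'I_l -> nat}) : bool :=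
  [forall x, (N x <= 1)%N] && ((\sum_x N x)%N == m).

Let margin_mass (c : {ffun 'I_n -> int}) N : margins c (wt col_height) (wt N) -> mass N ->
  (forall i j, (N (i, j) <= 1)%N) /\ (forall j, (\sum_i N (i, j))%N = col_height j) /\
  forall k, partial_sum c k = (\sum_(j < l) \sum_(i < n | (i < k)%N) N (i, j))%N.
Proof.
move=> /andP[/eqP <- /eqP/ffunP ch] /andP[/forallP N1 _]; split=> //; split=> [j|k].
  have e : col_margin (wt N) j = (\sum_i N (i, j))%N.
    by rewrite ffunE (big_morph Posz PoszD (erefl _)); apply: eq_bigr => i _; rewrite wtE.
  by have := ch j; rewrite wtE e => -[].
rewrite exchange_big (big_morph Posz PoszD (erefl _)); apply: eq_bigr => i _.
rewrite ffunE (big_morph Posz PoszD (erefl _)); apply: eq_bigr => j _; by rewrite ffunE.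
Qed.

Let dominated (c : {ffun 'I_n -> int}) N : margins c (wt col_height) (wt N) -> mass N ->
  forall k, partial_sum c k <= partial_sum (wt la) k.
Proof.
move=> mN mm k; have [N1 [Nc ->]] := margin_mass mN mm.
rewrite partial_sum_wt -sum_partial_columns lez_nat; apply: leq_sum => j _.
by apply: (@partial_column (fun i j => N (i, j))).
Qed.

(** In every column the first k rows of N hold at most as many ones as those of the Ferrers diagram.
    With row sums la the totals agree, so equality holds for each column and each k, and consecutive
    k determine the entries. *)
Let ferrers_unique N : margins (wt la) (wt col_height) (wt N) -> mass N -> N = ferrers.
Proof.
move=> mN mm; have [N1 [Nc pN]] := margin_mass mN mm.
have e k j : (\sum_(i < n | (i < k)%N) N (i, j) = \sum_(i < n | (i < k)%N) (j < la i : nat))%N.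
  have le j1 : (\sum_(i < n | (i < k)%N) N (i, j1) <= \sum_(i < n | (i < k)%N) (j1 < la i : nat))%N.
    exact: (@partial_column (fun i j => N (i, j))).
  have := pN k; rewrite partial_sum_wt -sum_partial_columns => -[] /eqP.
  rewrite eq_sym => /eqP ee; apply/eqP; rewrite eqn_leq le /=.
  move: ee; rewrite [in LHS](bigD1 j) //= [in RHS](bigD1 j) //= => ee.
  have : (\sum_(j1 < l | j1 != j) \sum_(i < n | (i < k)%N) N (i, j1) <=
          \sum_(j1 < l | j1 != j) \sum_(i < n | (i < k)%N) (j1 < la i : nat))%N.
    exact: leq_sum.
  by rewrite -(leq_add2l (\sum_(i < n | (i < k)%N) N (i, j))) ee leq_add2r.
apply/ffunP=> -[i j]; rewrite ffunE /=; apply/eqP.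
rewrite -(eqn_add2r (\sum_(i' < n | (i' < i)%N) N (i', j))).
have := e i.+1 j; rewrite (bigD1 i) //= [in RHS](bigD1 i) //= => e1.
have ei (F : 'I_n -> nat) : (\sum_(i' < n | (i' < i.+1)%N && (i' != i)) F i' =
    \sum_(i' < n | (i' < i)%N) F i')%N.
  by apply: eq_bigl => i'; rewrite ltnS (ltn_neqAle i') andbC.
by move: e1; rewrite !ei e => ->.
Qed.

Let ferrers_margins : margins (wt la) (wt col_height) (wt ferrers).
Proof.
apply/andP; split; apply/eqP/ffunP=> i; rewrite !ffunE; under eq_bigr do rewrite !ffunE.
  by rewrite -(big_morph Posz PoszD (erefl _)) /= sum_ltn_ord (minn_idPl (lal _)).
by rewrite -(big_morph Posz PoszD (erefl _)) /= -sum1_card [in RHS]big_mkcond.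
Qed.

Let ferrers_mass : mass ferrers.
Proof.
apply/andP; split; first by apply/forallP=> x; rewrite ffunE; case: (_ < _)%N.
rewrite (eq_bigr (fun x : 'I_n * 'I_l => (x.2 < la x.1 : nat)%N)) => [|x _]; last by rewrite ffunE.
rewrite -(pair_big xpredT xpredT (fun (i : 'I_n) (j : 'I_l) => (j < la i : nat)%N)) /=.
by apply/eqP/eq_bigr => i _; rewrite sum_ltn_ord (minn_idPl (lal _)).
Qed.

Let expand (c : {ffun 'I_n -> int}) :
  '[word_char m c, cfSign m * word_char m (wt col_height)] =
  \sum_(N : {ffun 'I_n * 'I_l -> 'I_m.+1} | margins c (wt col_height) (wt [ffun x => N x : nat]))
    (mass [ffun x => N x : nat])%:R.
Proof.
rewrite mulrC cfdot_word_charM (word_char_mul _ _ (leqnn m)) cfdot_suml.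
have e (N : {ffun 'I_n * 'I_l -> 'I_m.+1}) : ffun_int N = wt [ffun x => N x : nat].
  by apply/ffunP=> x; rewrite !ffunE.
by apply: eq_big => N; rewrite e // cfdot_word_char_wt_sign.
Qed.

(** The inner product counts the 0-1 matrices with row sums c and column sums conjugate to la; the
    existence of one gives the necessary condition of Gale and Ryser. *)
Lemma cfdot_word_char_sign_dominance (c : {ffun 'I_n -> int}) :
  '[word_char m c, cfSign m * word_char m (wt col_height)] != 0 ->
  forall k, partial_sum c k <= partial_sum (wt la) k.
Proof.
rewrite expand => nz; have [N /andP[mN mm]|nN] := pickP (fun N : {ffun 'I_n * 'I_l -> 'I_m.+1} =>
   margins c (wt col_height) (wt [ffun x => N x : nat]) && mass [ffun x => N x : nat]).
  exact: dominated mN mm.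
case/eqP: nz; rewrite big1 // => N mN; have := nN N; rewrite mN /= => -> //.
Qed.

Lemma cfdot_word_char_sign_diag : '[word_char m (wt la), cfSign m * word_char m (wt col_height)] = 1.
Proof.
rewrite expand; have fm x : (ferrers x < m.+1)%N.
  by rewrite ltnS; case/andP: ferrers_mass => _ /eqP <-; rewrite (bigD1 x) //= leq_addr.
pose F : {ffun 'I_n * 'I_l -> 'I_m.+1} := [ffun x => Ordinal (fm x)].
have eF : [ffun x => F x : nat] = ferrers by apply/ffunP=> x; rewrite !ffunE.
rewrite (bigD1 F) /=; last by rewrite eF ferrers_margins.
rewrite eF ferrers_mass big1 ?addr0 // => N /andP[mN nF].
case mm : mass => //; case/eqP: nF; have := ferrers_unique mN mm; rewrite -eF => /ffunP e.
by apply/ffunP=> x; apply: val_inj; have := e x; rewrite !ffunE.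
Qed.

End GaleRyser.

(** * Identification of the irreducible characters *)

(** Both sides say that the diagram of la has a box in row r and column j. *)
Lemma sorted_geq_count la j r : sorted geq la -> (r < count (ltn j) la)%N = (j < nth 0%N la r)%N.
Proof.
elim: la r => [|x s IHs] r; first by rewrite nth_nil.
move=> /= pxs; have ss := path_sorted pxs.
have /allP ax : all (geq x) s by apply: order_path_min pxs => a b c h1 h2; apply: leq_trans h2 h1.
have [jx|xj] /= := ltnP j x; first by case: r => [|r] /=; rewrite ?jx // add1n ltnS IHs.
have -> : count (ltn j) s = 0%N.
  apply/eqP; rewrite -leqn0 leqNgt -has_count; apply/hasPn => y /ax /= yx.
  by rewrite -leqNgt (leq_trans yx).
rewrite addn0 ltn0; case: r => [|r] /=; first by rewrite ltnNge xj.
apply/esym/negbTE; rewrite -leqNgt.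
have [rs|rs] := ltnP r (size s); last by rewrite nth_default.
by apply: leq_trans xj; apply: (ax _ (mem_nth _ rs)).
Qed.

Lemma nth_ge_length la i : sorted geq la -> (partition_length la <= i)%N -> nth 0%N la i = 0%N.
Proof.
by move=> ss; rewrite leqNgt sorted_geq_count // lt0n negbK => /eqP.
Qed.

Lemma sumn_ord n s : (forall i, (n <= i)%N -> nth 0%N s i = 0%N) ->
  sumn s = (\sum_(i < n) nth 0%N s i)%N.
Proof.
elim: s n => [|x s IHs] n h; first by rewrite big1 // => i _; rewrite nth_nil.
case: n h => [|n] h.
  rewrite big_ord0 /= (IHs 0%N) ?big_ord0 ?addn0; first exact: (h 0%N).
  by move=> i _; apply: (h i.+1).
rewrite big_ord_recl /= (IHs n) // => i ni; exact: (h i.+1).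
Qed.

Lemma card_reshape_index m a j : sumn a = m ->
  #|[pred i : 'I_m | reshape_index a i == j]| = nth 0%N a j.
Proof.
move=> sa; have [ja|aj] := ltnP j (size a); last first.
  rewrite nth_default // eq_card0 // => i; rewrite inE; apply/negbTE.
  have := reshape_indexP (_ : i < sumn a)%N; rewrite sa ltn_ord => /(_ isT) h.
  by rewrite neq_ltn (leq_trans h aj).
have fb (c : 'I_(nth 0%N a j)) : (flatten_index a j c < m)%N by rewrite -sa flatten_indexP.
pose f c := Ordinal (fb c).
have finj : injective f.
  move=> c1 c2 /(congr1 (fun i => reshape_offset a (val i))) /=.
  by rewrite !flatten_indexKr //; apply: val_inj.
rewrite -[RHS]card_ord -(card_codom finj); apply: eq_card => i.
rewrite inE; apply/eqP/codomP => [ij|[c ->]]; last by rewrite /= flatten_indexKl.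
have ia : (i < sumn a)%N by rewrite sa.
have co : (reshape_offset a i < nth 0%N a j)%N by rewrite -ij reshape_offsetP.
by exists (Ordinal co); apply: val_inj; rewrite /= -ij reshape_indexK.
Qed.

(** The Young subgroup is the stabilizer of the word whose letter at i is the block containing i. *)
Lemma young_Ind m n a : sumn a = m -> (forall i : 'I_m, (reshape_index a i < n)%N) ->
  'Ind[[set: 'S_m], young_subgroup m a] 1 = word_char m (ffun_seq n a).
Proof.
move=> sa h; pose w : {ffun 'I_m -> 'I_n} := [ffun i => Ordinal (h i)].
have -> : ffun_seq n a = content w.
  apply/ffunP=> j; rewrite !ffunE -(card_reshape_index j sa); congr Posz.
  by apply: eq_card => i; rewrite !inE ffunE.
rewrite word_char_Ind; suff -> : young_subgroup m a = wstab w by [].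
apply/val_inj/setP => s; rewrite !inE; apply/forallP/eqP => [hs|/ffunP hs i].
  by apply/ffunP=> i; rewrite !ffunE; apply/val_inj/eqP/hs.
by have := hs i; rewrite !ffunE => -[->].
Qed.

Lemma cfSign_char m : cfSign m \is a character.
Proof.
have sP : mx_repr [set: 'S_m] (fun s : 'S_m => ((-1) ^+ s)%:M : 'M[algC]_1).
  by split=> [|s u _ _]; rewrite ?odd_perm1 // odd_permM signr_addb scalar_mxM.
suff -> : cfSign m = cfRepr (MxRepresentation sP) by apply: cfRepr_char.
by apply/cfunP=> s; rewrite cfSignE cfunE inE mulr1n /= mxtrace_scalar.
Qed.

Definition part_wt n (la : seq nat) : {ffun 'I_n -> nat} := [ffun i : 'I_n => nth 0%N la i].

Section Identification.
Variables (m n : nat) (la : seq nat).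
Hypothesis laP : is_partition m la.
Hypothesis lan : (partition_length la <= n)%N.

Let las : sorted geq la. Proof. by case/andP: laP. Qed.

Lemma part_wt_nonincreasing : nonincreasing (part_wt n la).
Proof.
move=> i j; rewrite leq_eqVlt => /orP[/eqP/val_inj -> //|ij]; rewrite !ffunE.
have [js|sj] := ltnP j (size la); last by rewrite [X in (X <= _)%N]nth_default.
apply: (sorted_ltn_nth _ 0%N las) => //; rewrite ?inE ?(ltn_trans ij) //.
by move=> a b c h1 h2; apply: leq_trans h2 h1.
Qed.

Lemma part_wt_sum : (\sum_i part_wt n la i)%N = m.
Proof.
case/andP: laP => _ /eqP <-; rewrite (@sumn_ord n); last first.
  by move=> i ni; rewrite nth_ge_length // (leq_trans lan).
by apply: eq_bigr => i _; rewrite ffunE.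
Qed.

Let l := head 0%N la.

Let lal i : (part_wt n la i <= l)%N.
Proof.
rewrite ffunE /l -nth0; have [->//|i0] := posnP i.
have [js|sj] := ltnP i (size la); last by rewrite [X in (X <= _)%N]nth_default.
apply: (sorted_ltn_nth _ 0%N las) => //; rewrite ?inE ?(ltn_trans i0) //.
by move=> a b c h1 h2; apply: leq_trans h2 h1.
Qed.

Let col_heightE (j : 'I_l) : col_height l (part_wt n la) j = count (ltn j) la.
Proof.
rewrite ffunE; have cn : (count (ltn j) la <= n)%N.
  apply: leq_trans lan; apply: sub_count => x /=; exact: leq_ltn_trans.
rewrite -[RHS](minn_idPl cn) -sum_ltn_ord -sum1_card big_mkcond.
by apply: eq_bigr => i _; rewrite inE ffunE sorted_geq_count //; case: ifP.
Qed.

Let conj_wt : wt (col_height l (part_wt n la)) = ffun_seq l (conj_partition la).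
Proof. by apply/ffunP=> j; rewrite wtE col_heightE ffunE nth_mkseq. Qed.

Let sumn_conj : sumn (conj_partition la) = m.
Proof.
rewrite (@sumn_ord l) => [|i li]; last by rewrite nth_default // size_mkseq.
have -> : m = (\sum_(i < n | (i < n)%N) part_wt n la i)%N.
  by rewrite -[LHS]part_wt_sum; apply: eq_bigl => i; rewrite ltn_ord.
rewrite -(sum_partial_columns lal); apply: eq_bigr => j _.
rewrite nth_mkseq // -col_heightE ffunE -sum1_card big_mkcond [RHS]big_mkcond.
by apply: eq_bigr => i _; rewrite inE ltn_ord; case: (_ < _)%N.
Qed.

Let Ind1 : 'Ind[[set: 'S_m], young_subgroup m la] 1 = word_char m (wt (part_wt n la)).
Proof.
have sla : sumn la = m by case/andP: laP => _ /eqP.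
have -> : wt (part_wt n la) = ffun_seq n la by apply/ffunP=> i; rewrite !ffunE.
(* A block that contains an index is nonempty, so its number is below the length of la even when la
   has trailing zeros. *)
apply: young_Ind => // i; apply: leq_trans lan; rewrite sorted_geq_count //.
by apply: leq_ltn_trans (reshape_offsetP (_ : (i < sumn la)%N)); rewrite ?sla.
Qed.

(** The projection formula for induction takes the sign, restricted from [S_m], out of the induced
    character. *)
Let Ind_sign : 'Ind[[set: 'S_m], young_subgroup m (conj_partition la)] ('Res (cfSign m)) =
  cfSign m * word_char m (wt (col_height l (part_wt n la))).
Proof.
rewrite -['Res _]mul1r cfIndM ?subsetT // mulrC conj_wt (@young_Ind m l) // => i.
rewrite -[X in (_ < X)%N](size_mkseq (fun j => count (ltn j) la)).
by apply: reshape_indexP; rewrite -/(conj_partition la) sumn_conj.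
Qed.

(** The Jacobi-Trudi irreducible occurs once in each of the two induced characters, and these have
    inner product 1, so they share no other constituent. *)
Lemma sym_char_jacobi_trudi : sym_char m la = jacobi_trudi m (wt (part_wt n la) - ord_weight n).
Proof.
have lad := part_wt_nonincreasing; have sla := part_wt_sum.
have [i ei] := jacobi_trudi_irr lad sla; rewrite ei; congr 'chi__.
set psi := cfSign m * word_char m (wt (col_height l (part_wt n la))).
have psiC : psi \is a character by rewrite rpredM ?cfSign_char ?word_char_char.
have d1 : '[word_char m (wt (part_wt n la)), psi] = 1.
  by have := cfdot_word_char_sign_diag lad lal; rewrite sla.
have word_char_i : '[word_char m (wt (part_wt n la)), 'chi_i] = 1.
  by rewrite cfdotC_char ?irr_char ?word_char_char // -ei jacobi_trudi_diag.
(* Of the contents in the Jacobi-Trudi sum, only those dominated by la pair with [psi] to a nonzero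
   value, hence only w = 1 contributes. *)
have psi_i : '[psi, 'chi_i] = 1.
  rewrite -ei /jacobi_trudi cfdot_sumr (bigD1 1%g) //= odd_perm1 scale1r shiftw_ord_weight1.
  rewrite cfdotC_char ?word_char_char // d1 big1 ?addr0 // => w w1; rewrite cfdotZr.
  apply/eqP; rewrite mulf_eq0; apply/orP; right; apply: contraNT w1 => nz.
  apply/eqP/(@dominates_shiftw _ (wt (part_wt n la))) => k.
  move: nz; rewrite cfdotC_char ?word_char_char // => nz.
  by have := @cfdot_word_char_sign_dominance n l _ lad lal _ _ k; rewrite sla; apply.
rewrite /sym_Iirr; case: pickP => [j|/(_ i)]; last first.
  by rewrite /= Ind1 Ind_sign !irr_consttE word_char_i psi_i oner_eq0.
rewrite /= Ind1 Ind_sign !irr_consttE => /andP[word_char_j psi_j].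
apply/eqP; apply/negP => /negP ji; have := cfdot_char_r (word_char m (wt (part_wt n la))) psiC.
rewrite d1 (bigD1 i) //= (bigD1 j) //= word_char_i psi_i mulr1 => /eqP.
rewrite -subr_eq0 opprD addrA subrr sub0r oppr_eq0.
have nn (k : Iirr [set: 'S_m]) : 0 <= '[word_char m (wt (part_wt n la)), 'chi_k] * '[psi, 'chi_k].
  by rewrite mulr_ge0 // natr_ge0 // Cnat_cfdot_char_irr ?word_char_char.
by rewrite paddr_eq0 ?sumr_ge0 // mulf_eq0 (negPf word_char_j) (negPf psi_j).
Qed.

End Identification.

(** * Kronecker products *)

Lemma cfdot_jacobi_trudiM m n (k : {ffun 'I_n -> int}) (f g : 'CF([set: 'S_m])) :
  '[f * jacobi_trudi m k, g] = '[f, jacobi_trudi m k * g].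
Proof.
rewrite /jacobi_trudi mulr_sumr mulr_suml cfdot_suml cfdot_sumr; apply: eq_bigr => w _.
by rewrite -scalerAr -scalerAl cfdotZl cfdotZr rmorph_sign cfdot_word_charM.
Qed.

Section KroneckerShift.
Variables (T U : finType) (m t : nat).
Let n := #|{: T * U}|.
Let M := (m + n * t)%N.
Variables (la mu : {ffun 'I_n -> nat}).
Hypothesis lad : nonincreasing la.
Hypothesis sla : (\sum_i la i)%N = M.
Hypothesis muE : forall i, la i = (mu i + t)%N.

Lemma cfdot_jacobi_trudi_word_char_shift_fin (c : {ffun T * U -> int}) :
  '[jacobi_trudi M (wt la - ord_weight n), word_char M c] =
  '[jacobi_trudi m (wt mu - ord_weight n), word_char m (c - cst_weight _ t)].
Proof.
have fbij : bijective (@enum_val _ (mem {: T * U})) := enum_val_bij _.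
rewrite (word_char_reindex M c fbij) (word_char_reindex m _ fbij).
rewrite (cfdot_jacobi_trudi_word_char_shift lad sla muE).
by congr '[_, word_char m _]; apply/ffunP=> i; rewrite !ffunE.
Qed.

Let margins_shift (c : {ffun T -> int}) (d : {ffun U -> int}) (N : {ffun T * U -> int}) :
  margins c d (N + cst_weight _ t) = margins (c - cst_weight T (#|U| * t)) (d - cst_weight U (#|T| * t)) N.
Proof.
rewrite /margins -[row_margin N == _](inj_eq (addIr (cst_weight T (#|U| * t)))) subrK.
rewrite -[col_margin N == _](inj_eq (addIr (cst_weight U (#|T| * t)))) subrK.
congr (_ && _); congr (_ == _); apply/ffunP=> i; rewrite !ffunE.
  under eq_bigr do rewrite !ffunE.
  by rewrite big_split sumr_const /= -mulr_natl natz PoszM.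
under eq_bigr do rewrite !ffunE.
by rewrite big_split sumr_const /= -mulr_natl natz PoszM.
Qed.

(** Both products are expanded over the matrices with the prescribed margins; the translation
    identity applies to each matrix, and subtracting t from all entries matches the two families. *)
Lemma cfdot_jacobi_trudi_word_charM_shift (c : {ffun T -> int}) (d : {ffun U -> int}) :
  '[jacobi_trudi M (wt la - ord_weight n), word_char M c * word_char M d] =
  '[jacobi_trudi m (wt mu - ord_weight n),
    word_char m (c - cst_weight T (#|U| * t)) * word_char m (d - cst_weight U (#|T| * t))].
Proof.
have mM : (m <= M)%N by apply: leq_addr.
rewrite (word_char_mul _ _ (leqnn M)) (word_char_mul _ _ mM) !cfdot_sumr.
under eq_bigr do rewrite cfdot_jacobi_trudi_word_char_shift_fin.
pose g (N : {ffun T * U -> int}) := '[jacobi_trudi m (wt mu - ord_weight n), word_char m N].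
pose X := {ffun T * U -> 'I_M.+1}.
rewrite -[LHS]/(\sum_(N : X | _) g (ffun_int N - cst_weight _ t)) -[RHS]/(\sum_(N : X | _) g (ffun_int N)).
have gP N : g N != 0 -> forall x, 0 <= N x <= m%:Z.
  move=> gN; have [|al -> sal x] := @word_char_natP m _ N.
    by apply: contraNneq gN => e; rewrite /g e cfdot0r.
  by rewrite wtE /= lez_nat -sal (bigD1 x) //= leq_addr.
(* With bounded entries, translation by t is only a partial map. Nonzero terms come from contents
   with entries between 0 and m, and on these [up] and [down] are mutually inverse. *)
have nz (P : pred X) (F : X -> algC) :
    \sum_(N | P N) F N = \sum_(N | P N && (F N != 0)) F N.
  by rewrite [RHS]big_mkcondr; apply: eq_bigr => N _; case: eqP.
rewrite nz [RHS]nz.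
pose up (N : X) : X := [ffun x => inord (N x + t)].
pose down (N : X) : X := [ffun x => inord (N x - t)].
have tM (x : T * U) : (m + t <= M)%N.
  by rewrite leq_add2l leq_pmull // /n; apply/card_gt0P; exists x.
have upE N : g (ffun_int N) != 0 -> ffun_int (up N) = ffun_int N + cst_weight _ t.
  move=> gN; apply/ffunP=> x; rewrite !ffunE inordK // ltnS (leq_trans _ (tM x)) // leq_add2r.
  by have := gP _ gN x; rewrite ffunE.
have downE N : g (ffun_int N - cst_weight _ t) != 0 -> ffun_int (down N) = ffun_int N - cst_weight _ t.
  move=> gN; apply/ffunP=> x; have := gP _ gN x; rewrite !ffunE => /andP[h _].
  have tN : (t <= N x)%N by move: h; rewrite subr_ge0.
  by rewrite inordK ?subzn // ltnS (leq_trans (leq_subr _ _)) // -ltnS.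
have upK N : g (ffun_int N) != 0 -> down (up N) = N.
  move=> gN; apply: ffun_int_inj; have e := upE N gN.
  by rewrite downE; rewrite e addrK.
have downK N : g (ffun_int N - cst_weight _ t) != 0 -> up (down N) = N.
  move=> gN; apply: ffun_int_inj; have e := downE N gN.
  by rewrite upE; rewrite e ?subrK.
rewrite (reindex_onto up down) => [|N /andP[_ gN]]; last exact: downK.
apply: eq_big => [N|N]; last first.
  by move=> /andP[/andP[_ gN] /eqP e]; rewrite -(downE _ gN) e.
apply/idP/idP => [/andP[/andP[mN gN] /eqP e]|/andP[mN gN]].
  have eN : ffun_int N = ffun_int (up N) - cst_weight _ t by rewrite -(downE _ gN) e.
  by rewrite -margins_shift eN subrK mN.
by rewrite upK // upE // addrK gN eqxx margins_shift mN.
Qed.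

End KroneckerShift.

Lemma vec_sub_nth (a : seq nat) n s i : sorted geq a -> (partition_length a <= n)%N ->
  nth 0%N (vec_sub a (nseq n s)) i = (nth 0%N a i - s)%N.
Proof.
move=> sa an; have [im|mi] := ltnP i (maxn (size a) (size (nseq n s))).
  rewrite nth_mkseq // nth_nseq; case: ltnP => // ni.
  by rewrite nth_ge_length ?sub0n // (leq_trans an).
rewrite nth_default ?size_mkseq // nth_default ?sub0n //.
by apply: leq_trans mi; apply: leq_maxl.
Qed.

Lemma part_wt_ge M (a : seq nat) n s : is_partition M a ->
  partition_length a = n -> (s <= part a n)%N -> forall i, (s <= part_wt n a i)%N.
Proof.
move=> aP an sp i; have n_gt0 : (0 < n)%N := leq_ltn_trans (leq0n i) (ltn_ord i).
have n1 : (n.-1 < n)%N by rewrite prednK.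
have h : nonincreasing (part_wt n a) := part_wt_nonincreasing aP.
apply: leq_trans sp _; have := h i (Ordinal n1).
by rewrite !ffunE /part /=; apply; rewrite -ltnS prednK.
Qed.

(** The first n parts of a are at least [part a n], hence at least s, so the truncated subtraction
    is exact on them. *)
Lemma vec_sub_partition M (a : seq nat) n s : is_partition M a ->
  partition_length a = n -> (s <= part a n)%N ->
  [/\ (n * s <= M)%N, is_partition (M - n * s) (vec_sub a (nseq n s)),
      (partition_length (vec_sub a (nseq n s)) <= n)%N &
      forall i : 'I_n, part_wt n a i = (part_wt n (vec_sub a (nseq n s)) i + s)%N].
Proof.
move=> aP an sp; have sa : sorted geq a by case/andP: aP.
have an' : (partition_length a <= n)%N by rewrite an.
have nthE i := vec_sub_nth s i sa an'.
have vz i : (n <= i)%N -> nth 0%N (vec_sub a (nseq n s)) i = 0%N.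
  by move=> ni; rewrite nthE nth_ge_length ?sub0n // an.
have e (i : 'I_n) : part_wt n a i = (part_wt n (vec_sub a (nseq n s)) i + s)%N.
  by have := part_wt_ge aP an sp i; rewrite !ffunE nthE => /subnK.
have sv : sorted geq (vec_sub a (nseq n s)).
  apply/(sortedP 0%N) => i; rewrite size_mkseq => im; rewrite !nthE /= leq_sub2r //.
  have [ia|ai] := ltnP i.+1 (size a); last by rewrite [X in (X <= _)%N]nth_default.
  by move/(sortedP 0%N): sa; apply.
have eM : (sumn (vec_sub a (nseq n s)) + n * s)%N = M.
  rewrite (sumn_ord vz) -[RHS](part_wt_sum aP an') -[in (n * s)%N](card_ord n) -sum_nat_const.
  by rewrite -big_split; apply: eq_bigr => i _; rewrite e ffunE.
split=> //; first by rewrite -eM leq_addl.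
- by rewrite /is_partition sv -eM addnK /=.
- by rewrite leqNgt sorted_geq_count // -ltnNge ltnS vz.
Qed.

Lemma cfdot_jacobi_trudi2 m n n' (f : 'CF([set: 'S_m])) (k : {ffun 'I_n -> int}) (k' : {ffun 'I_n' -> int}) :
  '[f, jacobi_trudi m k * jacobi_trudi m k'] =
  \sum_(w : 'S_n) \sum_(w' : 'S_n') (-1) ^+ w * (-1) ^+ w' *
    '[f, word_char m (shiftw k w) * word_char m (shiftw k' w')].
Proof.
rewrite mulr_suml cfdot_sumr; apply: eq_bigr => w _.
rewrite mulr_sumr cfdot_sumr; apply: eq_bigr => w' _.
by rewrite -scalerAl -scalerAr scalerA cfdotZr rmorphM !rmorph_sign.
Qed.

Lemma shiftw_cst n t (k : {ffun 'I_n -> int}) w :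
  shiftw k w - cst_weight 'I_n t = shiftw (k - cst_weight 'I_n t) w.
Proof. by apply/ffunP=> i; rewrite !ffunE addrAC. Qed.

(** After [ord_weight n] is added back, the last entry is [part a n] minus s, which is negative.
    This is the vanishing in case (1). *)
Lemma jacobi_trudi_part_neg M (a : seq nat) n s : (0 < n)%N -> is_partition M a ->
  (part a n < s)%N -> forall m, jacobi_trudi m (wt (part_wt n a) - ord_weight n - cst_weight 'I_n s) = 0.
Proof.
move=> n_gt0 aP ps m; have n1 : (n.-1 < n)%N by rewrite prednK.
have kd : decreasing (wt (part_wt n a) - ord_weight n - cst_weight 'I_n s).
  move=> i j ij; have := wt_decreasing (part_wt_nonincreasing aP (n := n)) ij.
  rewrite [X in _ -> X < _]ffunE [X in _ -> _ < X]ffunE.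
  by rewrite ![(- cst_weight _ _) _]ffunE !(ffunE (fun=> s%:Z)) ltrD2r.
apply: (jacobi_trudi_neg m (i := Ordinal n1) kd).
by rewrite !ffunE /= addrAC subrK subr_lt0 ltz_nat.
Qed.

Local Close Scope ring_scope.

Theorem theorem4p5 (m : nat) (la mu nu : seq nat) (p q r t : nat)
    (m_gt0 : 0 < m)
    (la_part : is_partition m la)
    (mu_part : is_partition m mu)
    (nu_part : is_partition m nu)
    (la_length : partition_length la = p)
    (mu_length : partition_length mu = q)
    (nu_length : partition_length nu = r)
    (t_def : t = part la p)
    (p_eq : p = q * r) :
  (part mu q < r * t \/ part nu r < q * t -> kron la mu nu = 0%R) /\
  (r * t <= part mu q -> q * t <= part nu r ->
     kron la mu nu =
     kron (vec_sub la (nseq p t))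
          (vec_sub mu (nseq q (r * t)))
          (vec_sub nu (nseq r (q * t)))).
Proof.
Local Open Scope ring_scope.
pose n := #|{: 'I_q * 'I_r}|.
have np : n = p by rewrite /n card_prod !card_ord.
have la_n : partition_length la = n by rewrite np.
have len_gt0 a : is_partition m a -> (0 < partition_length a)%N.
  case/andP=> a_sorted /eqP sa; rewrite lt0n; apply: contraTneq m_gt0 => a0.
  by rewrite -sa (@sumn_ord 0) ?big_ord0 // => i _; rewrite nth_ge_length ?a0.
have q_gt0 : (0 < q)%N by rewrite -mu_length len_gt0.
have r_gt0 : (0 < r)%N by rewrite -nu_length len_gt0.
have [ntm la'_part la'_n la'E] : [/\ (n * t <= m)%N, is_partition (m - n * t) (vec_sub la (nseq n t)),
    (partition_length (vec_sub la (nseq n t)) <= n)%N &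
      forall i : 'I_n, part_wt n la i = (part_wt n (vec_sub la (nseq n t)) i + t)%N].
  by apply: vec_sub_partition; rewrite // np t_def.
set m0 := (m - n * t)%N in la'_part; have em : (m0 + n * t)%N = m by rewrite subnK.
clearbody m0; subst m.
(* This formula serves both cases: a factor on the right vanishes in case (1), and in case (2) both
   factors are the characters of the translated partitions. *)
have main : kron la mu nu =
  '[sym_char m0 (vec_sub la (nseq n t)),
    jacobi_trudi m0 (wt (part_wt q mu) - ord_weight q - cst_weight 'I_q (r * t)) *
    jacobi_trudi m0 (wt (part_wt r nu) - ord_weight r - cst_weight 'I_r (q * t))].
  rewrite /kron; have -> : sumn la = (m0 + n * t)%N by case/andP: la_part => _ /eqP.
  rewrite (sym_char_jacobi_trudi la'_part la'_n) (@sym_char_jacobi_trudi _ n la) ?la_n //.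
  rewrite (@sym_char_jacobi_trudi _ q mu) ?mu_length // (@sym_char_jacobi_trudi _ r nu) ?nu_length //.
  rewrite cfdot_jacobi_trudiM !cfdot_jacobi_trudi2; apply: eq_bigr => w _; apply: eq_bigr => w' _.
  have lad : nonincreasing (part_wt n la) := part_wt_nonincreasing la_part.
  have sla : (\sum_i part_wt n la i = m0 + n * t)%N by apply: part_wt_sum; rewrite ?la_n.
  by rewrite (cfdot_jacobi_trudi_word_charM_shift lad sla la'E) !shiftw_cst !card_ord.
split=> [h|rt qt].
  rewrite main; case: h => h.
    by rewrite (jacobi_trudi_part_neg q_gt0 mu_part h) mul0r cfdot0r.
  by rewrite (jacobi_trudi_part_neg r_gt0 nu_part h) mulr0 cfdot0r.
have tilde a k s : is_partition (m0 + n * t) a -> partition_length a = k -> (s <= part a k)%N ->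
    (k * s = n * t)%N ->
  sym_char m0 (vec_sub a (nseq k s)) = jacobi_trudi m0 (wt (part_wt k a) - ord_weight k - cst_weight 'I_k s).
  move=> aP ak sak ks; have [_ vP vk vE] := vec_sub_partition aP ak sak.
  rewrite (@sym_char_jacobi_trudi _ k) //; last by rewrite ks addnK in vP.
  congr jacobi_trudi; rewrite addrAC; congr (_ - _); apply/ffunP=> i.
  by rewrite !ffunE -[nth 0%N a i](ffunE (fun i : 'I_k => nth 0%N a i)) -/(part_wt k a) vE ffunE PoszD addrK.
(* The three translations remove the same total qrt, so the resulting partitions have the same
   degree. *)
have nt : (n * t = q * (r * t))%N by rewrite np p_eq mulnA.
rewrite main /kron -np; have -> : sumn (vec_sub la (nseq n t)) = m0.
  by case/andP: la'_part => _ /eqP.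
by rewrite (tilde mu) // (tilde nu) ?cfdot_jacobi_trudiM // nt mulnCA.
Qed.
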